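(* Let $k,\ell\ge 0$ be integers, not both zero. Let $M$ be an ergodic central measure on the space $\mathcal T(\mathbb Y)$ of infinite paths in the Young graph that is supported on the set of paths all of whose vertices $\lambda$ lie in the $(k,\ell)$-hook, i.e. satisfy $\lambda_{k+1}\le \ell$ (the diagram is contained in the union of its first $k$ rows and first $\ell$ columns). Then there exist real vectors $\alpha=(\alpha_1,\dots,\alpha_k)$ with $\alpha_1\ge\dots\ge\alpha_k\ge0$ and $\beta=(\beta_1,\dots,\beta_\ell)$ with $\beta_1\ge\dots\ge\beta_\ell\ge0$, satisfying $\sum_{i=1}^k\alpha_i+\sum_{j=1}^\ell\beta_j=1$, such that $M$ is the Thoma measure $\mathcal M_{(\alpha,\beta,0)}$; that is, $$M(C_\lambda)=\dim\lambda\cdot \tilde s_\lambda(\alpha,\beta)\quad\text{for every Young diagram }\lambda .$$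
   Context: The Young graph $\mathbb Y$ is the graded graph whose vertices of level $n$ are the Young diagrams (partitions) with $n$ cells, with an edge from $\lambda$ to $\mu$ when $\mu$ is obtained from $\lambda$ by adding one cell; $\dim\lambda$ is the number of paths from $\emptyset$ to $\lambda$ (the number of standard Young tableaux of shape $\lambda$). $\mathcal T(\mathbb Y)$ is the space of infinite paths $(\lambda^{(0)}=\emptyset,\lambda^{(1)},\lambda^{(2)},\dots)$ in $\mathbb Y$ (equivalently, infinite standard Young tableaux) with its natural product Borel structure, and $C_\lambda\subset\mathcal T(\mathbb Y)$ is the set of paths passing through $\lambda$. A Borel probability measure $M$ on the infinite path space of a graded graph is central if for every vertex $v$ of any level $n$ with positive probability of being visited, conditionally on passing through $v$ at level $n$ and on the path after level $n$, all finite paths from $\emptyset$ to $v$ are equally probable. A central measure is ergodic if every Borel set that is a union of classes of the tail equivalence relation (two paths are equivalent if they coincide from some level on) has measure $0$ or $1$; equivalently, $M$ is an extreme point of the set of central measures. Let $\widetilde{\mathcal A}=\{1,\dots,k\}\cup\{1^*,\dots,\ell^*\}$ with order $1<2<\dots<k<\ell^*<\dots<2^*<1^*$. A $(k,\ell)$-semistandard tableau of shape $\lambda$ is a filling of the cells of $\lambda$ with symbols from $\widetilde{\mathcal A}$ that is weakly increasing along rows and down columns, such that each $i\in\{1,\dots,k\}$ occurs at most once in every column and each $j^*$ occurs at most once in every row. The generalized (hook) Schur function is $$\tilde s_\lambda(\alpha,\beta)=\sum_{S}\ \prod_{i=1}^k\alpha_i^{m_i(S)}\prod_{j=1}^\ell\beta_j^{m_{j^*}(S)},$$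 the sum being over all $(k,\ell)$-semistandard tableaux $S$ of shape $\lambda$, where $m_a(S)$ is the number of occurrences of the symbol $a$ in $S$. The Thoma measure $\mathcal M_{(\alpha,\beta,0)}$ is the central measure on $\mathcal T(\mathbb Y)$ determined by $\mathcal M_{(\alpha,\beta,0)}(C_\lambda)=\dim\lambda\cdot\tilde s_\lambda(\alpha,\beta)$ for all $\lambda$. *)

(* Defs.v *)
From HB Require Import structures.
From mathcomp Require Import all_boot all_order all_algebra.
From mathcomp Require Import finmap.
From mathcomp Require Import all_classical all_reals all_analysis.

Set Implicit Arguments.
Unset Strict Implicit.
Unset Printing Implicit Defensive.

Import Order.TTheory GRing.Theory Num.Theory.
Import numFieldNormedType.Exports.

Local Open Scope classical_set_scope.
Local Open Scope ring_scope.

(* Row lengths, in weakly decreasing order and without trailing zeros;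
   [nth 0 la i] is the length of row i (rows are numbered from 0). *)
Definition is_diagram (s : seq nat) : bool := sorted geq s && (0%N \notin s).

Record diagram := Diagram { rows :> seq nat; _ : is_diagram rows }.
HB.instance Definition _ := [isSub for rows].
HB.instance Definition _ := [Countable of diagram by <:].

Lemma empty_diagram_subproof : is_diagram [::]. Proof. by []. Qed.
Definition empty_diagram : diagram := Diagram empty_diagram_subproof.

Definition level (la : diagram) : nat := sumn la.

(* [incr_nth s i] adds a cell at the end of row i; i = size la is a new row. *)
Definition young_edge : rel diagram := fun la mu =>
  [exists i : 'I_(size la).+1, rows mu == incr_nth la i].

(* A finite path from the empty diagram is given by its vertices of positive
   level, i.e. the initial vertex is omitted from the sequence. *)
Definition is_fpath (la : diagram) (p : seq diagram) : bool :=
  path young_edge empty_diagram p && (last empty_diagram p == la).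

(* [fset_set] returns the empty set on infinite sets; finite_fpaths below shows
   that it is not used in that way here. *)
Definition young_dim (la : diagram) : nat :=
  #|` fset_set [set p : seq diagram | is_fpath la p]|%fset.

Lemma sumn_incr_nth s i : sumn (incr_nth s i) = (sumn s).+1.
Proof.
elim: s i => [|n s IH] [|i] //=; last by rewrite IH addnS.
by elim: i => //= i ->.
Qed.

Lemma finite_fpaths (la : diagram) :
  finite_set [set p : seq diagram | is_fpath la p].
Proof.
have fin n v : finite_set [set p | size p = n /\ path young_edge v p].
  elim: n v => [|n IH] v.
    by apply: (@sub_finite_set _ _ [set [::]]) => [p [/size0nil->]|].
  have finS : finite_set [set w | young_edge v w].
    apply: (@sub_finite_set _ _ (rows @^-1`
        [set incr_nth v i | i in [set` iota 0 (size v).+1]])).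
      move=> w /existsP[i /eqP wE]; exists (nat_of_ord i); last by rewrite wE.
      by change (is_true (nat_of_ord i \in iota 0 (size v).+1)); rewrite mem_iota ltn_ord.
    apply: finite_preimage; first by move=> x y _ _; exact: val_inj.
    exact: finite_image.
  apply: (@sub_finite_set _ _ (\bigcup_(w in [set w | young_edge v w])
      [set w :: q | q in [set q | size q = n /\ path young_edge w q]])).
    move=> [|w q] [] //= [sq] /andP[vw wq].
    by exists w => //; exists q.
  by apply: bigcup_finite => // w _; exact: finite_image.
pose F n := [set p | size p = n /\ path young_edge empty_diagram p].
apply: (@sub_finite_set _ _ (F (level la))) => [p /andP[pp /eqP lp]|]; last exact: fin.
split=> //; rewrite -lp.
suff H v : path young_edge v p -> level (last v p) = (level v + size p)%N by rewrite H.
elim: p v {pp lp} => [|w p IH] v /=; first by rewrite addn0.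
case/andP=> /existsP[i /eqP wE] /IH ->.
by rewrite /level wE sumn_incr_nth addSnnS.
Qed.

Record ipath := IPath {
  vertex :> nat -> diagram ;
  vertex0 : vertex 0%N = empty_diagram ;
  vertexS : forall n, young_edge (vertex n) (vertex n.+1) }.

HB.instance Definition _ := gen_eqMixin ipath.
HB.instance Definition _ := gen_choiceMixin ipath.

Lemma one_row_subproof n : is_diagram (nseq (n != 0%N) n).
Proof. by case: n. Qed.

Lemma one_row_edge n : young_edge (Diagram (one_row_subproof n))
  (Diagram (one_row_subproof n.+1)).
Proof. by case: n => [|n]; apply/existsP; exists ord0. Qed.

Lemma one_row0 : Diagram (one_row_subproof 0) = empty_diagram.
Proof. exact: val_inj. Qed.

Definition one_row_path : ipath :=
  @IPath (fun n => Diagram (one_row_subproof n)) one_row0 one_row_edge.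

HB.instance Definition _ := isPointed.Build ipath one_row_path.

(* The restriction to paths of the product of the discrete Borel structures on
   the sets of vertices of each level. *)
Definition cylinders : set (set ipath) :=
  [set [set t : ipath | t n = la] | n in [set: nat] & la in [set: diagram]].

Definition path_space := g_sigma_algebraType cylinders.

(* C_la *)
Definition through (la : diagram) : set path_space :=
  [set t : ipath | exists n, t n = la].

Definition starts_with (p : seq diagram) : set path_space :=
  [set t : ipath | forall i, (i <= size p)%N ->
     t i = nth empty_diagram (empty_diagram :: p) i].

(* The sigma-algebra generated by the part of the path after level n. *)
Definition after (n : nat) : set (set path_space) :=
  <<s [set [set t : ipath | t m = mu]
      | m in [set m | (n < m)%N] & mu in [set: diagram]] >>.

(* g is a version of the conditional probability of E given the sub-sigma-algebra
   F, under the conditional measure P(. | C) = P(. `&` C) / P C with P C > 0; the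
   factor 1 / P C, common to both sides of the last equation, is cancelled. *)
Definition is_cond_prob (R : realType) d (T : measurableType d)
    (P : probability T R) (C : set T) (F : set (set T)) (E : set T)
    (g : T -> R) : Prop :=
  [/\ forall B : set R, measurable B -> F (g @^-1` B),
      P.-integrable C (EFin \o g) &
      forall A, F A ->
        (\int[P]_(x in A `&` C) (g x)%:E)%E = P (E `&` A `&` C)].

(* One function g serves all finite paths p ending at la: they have the same
   conditional probability. *)
Definition central (R : realType) (M : probability path_space R) : Prop :=
  forall la : diagram, (0 < M (through la))%E ->
    exists g : path_space -> R, forall p, is_fpath la p ->
      is_cond_prob M (through la) (after (level la)) (starts_with p) g.

Definition tail_equiv (s t : ipath) : Prop :=
  exists N, forall n, (N <= n)%N -> s n = t n.

Definition ergodic (R : realType) (M : probability path_space R) : Prop :=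
  forall A : set path_space, measurable A ->
    (forall s t : path_space, tail_equiv s t -> A s -> A t) ->
    M A = 0%E \/ M A = 1%E.

(* The length of row k + 1 is [nth 0 la k]. *)
Definition in_hook (k l : nat) (la : diagram) : bool := (nth 0 la k <= l)%N.

Definition hook_paths (k l : nat) : set path_space :=
  [set t : ipath | forall n, in_hook k l (t n)].

Definition cell (la : diagram) : finType :=
  {i : 'I_(size la) & 'I_(nth 0%N la i)}.
Definition row_of (la : diagram) (c : cell la) : nat := tag c.
Definition col_of (la : diagram) (c : cell la) : nat := tagged c.

(* [inl i] is the symbol i + 1 and [inr j] the symbol (j + 1)^*. *)
Definition symbol (k l : nat) : finType := ('I_k + 'I_l)%type.

Definition symbol_le (k l : nat) (a b : symbol k l) : bool :=
  match a, b with
  | inl i, inl i' => (i <= i')%N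
  | inl _, inr _ => true
  | inr _, inl _ => false
  | inr j, inr j' => (j' <= j)%N
  end.

Definition filling (k l : nat) (la : diagram) : finType :=
  {ffun cell la -> symbol k l}.

Definition semistandard (k l : nat) (la : diagram) (S : filling k l la) : bool :=
  [&& [forall c : cell la, forall d : cell la,
         (row_of c == row_of d) && (col_of c <= col_of d)%N ==>
         symbol_le (S c) (S d)],
      [forall c : cell la, forall d : cell la,
         (col_of c == col_of d) && (row_of c <= row_of d)%N ==>
         symbol_le (S c) (S d)],
      [forall i : 'I_k, forall c : cell la, forall d : cell la,
         [&& col_of c == col_of d, S c == inl i & S d == inl i] ==> (c == d)] &
      [forall j : 'I_l, forall c : cell la, forall d : cell la,
         [&& row_of c == row_of d, S c == inr j & S d == inr j] ==> (c == d)]].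

Definition mult (k l : nat) (la : diagram) (S : filling k l la)
    (a : symbol k l) : nat := #|[set c | S c == a]|.

Definition hook_schur (R : realType) (k l : nat) (la : diagram)
    (alpha : 'I_k -> R) (beta : 'I_l -> R) : R :=
  \sum_(S : filling k l la | semistandard S)
    ((\prod_(i < k) alpha i ^+ mult S (inl i)) *
     (\prod_(j < l) beta j ^+ mult S (inr j))).

(* Main.v *)
Require Import Defs.
From mathcomp Require Import all_boot all_order all_algebra.
From mathcomp Require Import finmap.
From mathcomp Require Import all_classical all_reals all_analysis.
From mathcomp Require Import zify ring lra.

Set Implicit Arguments.
Unset Strict Implicit.
Unset Printing Implicit Defensive.
Import Order.TTheory GRing.Theory Num.Theory.
Import numFieldNormedType.Exports.
Local Open Scope classical_set_scope.
Local Open Scope ring_scope.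

(** A central measure M is determined by one function of diagrams: by
    centrality the probability of following a finite path p depends only on
    the endpoint la of p. Call it phi(la) ([path_weight]). Then M(C_la) is
    dim la * phi(la), and phi is nonnegative, normalised at the empty diagram,
    harmonic for the Young graph, and zero outside the (k, l)-hook. It has to
    be shown that phi is a hook Schur function.

    Ergodicity enters through a law of large numbers. Fix m and a kind of
    strip (horizontal or vertical). To the i-th block of m consecutive steps of
    a path attach the number [block]: the indicator that the m steps form a
    strip, divided by the number of paths joining the two ends of the block.
    Summing this weight over all ways to cross the block counts each strip
    once. Adding strips commutes with adding one cell, because the middle
    diagram of two consecutive horizontal strips can be reflected row by row
    between the two extreme ones, and likewise for vertical strips and columns
    (the involution [strip_reflect] of Bender and Knuth).
    Hence the correlation of two distinct blocks does not depend on their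
    positions, and averages of blocks over the windows [16^j, 2 * 16^j) have
    consecutive differences of second moment at most 2 / 16^j. These averages
    therefore stabilise along almost every path; the events that they are
    eventually bounded by q are invariant under tail equivalence, so the limit
    is a constant c. Comparing the averages with the event of starting with a
    path to la gives the Pieri rule ([path_weight_eigen]): the sum of phi(mu)
    over the mu such that mu/la is a strip of size m is c * phi(la).

    From the Pieri rules the parameters are peeled off one at a time
    ([peel_row]). Let h_r be phi of the row with r cells, and suppose that no
    h_r vanishes. The sequence h is log-concave, so h_(r+1) / h_r tends to some
    alpha >= 0. By induction on the size of la, the quotients
    phi(r, la) / h_r of the diagrams with a first row r on top of la converge to
    some phi'(la), and phi is obtained from phi' by adding a horizontal strip
    weighted by powers of alpha. The function phi' obeys the Pieri rules
    again, and its support lies in a hook with one row less. Conjugating diagrams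
    gives the same for columns and vertical strips. In a hook without rows some
    h_r vanishes, so that the peeling stops; when h and its column analogue both
    vanish somewhere, only the empty diagram carries weight
    ([positive_pieri_degenerate]). So phi is obtained from the delta function
    at the empty diagram by k horizontal and l vertical weighted strips, which
    may be reordered by the same reflection ([strip_down_comm]); a hook Schur
    function is exactly such a sum, a tableau being the chain of diagrams
    filled by its successive symbols ([ordinal_schurS]). *)

Implicit Types la mu nu rho : diagram.

(** * Diagrams through their row lengths *)

(** The length of row i, zero when the row does not exist. *)
Definition row_len (la : diagram) (i : nat) : nat := nth 0%N la i.

Lemma row_len_gt0 la i : (0 < row_len la i)%N = (i < size la)%N.
Proof.
rewrite /row_len; case: (ltnP i (size la)) => [lti|gei]; last by rewrite nth_default.
case: la lti => s /= /andP[_ s0] lti.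
by rewrite lt0n; apply: contra s0 => /eqP <-; exact: mem_nth.
Qed.

Lemma row_len_anti la i j : (i <= j)%N -> (row_len la j <= row_len la i)%N.
Proof.
move=> leij; case: (ltnP j (size la)) => [ltj|]; last first.
  by move=> gej; rewrite {1}/row_len nth_default.
rewrite /row_len; case: la ltj => s /= /andP[ss _] ltj.
have tr : transitive geq by move=> a b c /= ab bc; exact: leq_trans bc ab.
apply: (sorted_leq_nth tr) => //=; rewrite ?inE //; first by move=> a /=.
exact: leq_ltn_trans ltj.
Qed.

Lemma row_len_ext la mu : row_len la =1 row_len mu -> la = mu.
Proof.
move=> E; apply/val_inj/(@eq_from_nth _ 0%N) => [|i _]; last exact: E.
apply/eqP; rewrite eqn_leq; apply/andP; split; rewrite leqNgt; apply/negP.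
  by rewrite -row_len_gt0 E row_len_gt0 ltnn.
by rewrite -row_len_gt0 -E row_len_gt0 ltnn.
Qed.

(** The diagram with row lengths f; it is meaningful only when f is weakly
    decreasing and vanishes at d (see [row_len_diagram_of]). *)
Definition diagram_of (f : nat -> nat) (d : nat) : diagram :=
  insubd empty_diagram (mkseq f (find (fun i => f i == 0%N) (iota 0 d))).

Lemma row_len_diagram_of f d : (forall i, (f i.+1 <= f i)%N) -> f d = 0%N ->
  row_len (diagram_of f d) =1 f.
Proof.
move=> fS fd i; rewrite /diagram_of; set e := find _ _.
have anti a b : (a <= b)%N -> (f b <= f a)%N.
  move=> ab; rewrite -(subnK ab); elim: (b - a)%N => [//|n IH].
  exact: leq_trans (fS _) IH.
have le_ed : (e <= d)%N by rewrite -[leqRHS](size_iota 0) find_size.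
have fe : f e = 0%N.
  have [hs|/hasNfind] := boolP (has (fun i => f i == 0%N) (iota 0 d)).
    have := nth_find 0%N hs; rewrite -/e nth_iota ?add0n; first by move/eqP.
    by rewrite -[ltnRHS](size_iota 0) -has_find.
  by rewrite size_iota -/e => ->.
have fpos j : (j < e)%N -> (0 < f j)%N.
  move=> lje; have := before_find 0%N lje.
  by rewrite nth_iota ?(leq_trans lje) // add0n lt0n => ->.
rewrite /row_len val_insubd; case: ifPn => [_|/negP[]].
  have [lti|gei] := ltnP i e; first by rewrite nth_mkseq.
  by rewrite nth_default ?size_mkseq //; apply/esym/eqP; rewrite -leqn0 -fe anti.
apply/andP; split; last first.
  by apply/mapP => -[j]; rewrite mem_iota add0n => /fpos + E; rewrite -E.
have tr : transitive geq by move=> a b c /= ab bc; exact: leq_trans bc ab.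
rewrite /mkseq sorted_map; apply: sub_sorted (iota_sorted 0 e).
by move=> a b /anti.
Qed.

Lemma row_len_empty i : row_len empty_diagram i = 0%N.
Proof. exact: nth_nil. Qed.

Lemma row_len_size la : row_len la (size la) = 0%N.
Proof. by apply/eqP; rewrite -leqn0 leqNgt row_len_gt0 ltnn. Qed.

Lemma row_len_ge la i : (size la <= i)%N -> row_len la i = 0%N.
Proof. exact: nth_default. Qed.

Lemma level_row_len la d : (size la <= d)%N -> level la = (\sum_(i < d) row_len la i)%N.
Proof.
move=> sd; rewrite /level sumnE (big_nth 0%N) big_mkord.
rewrite (big_ord_widen d (fun i => nth 0%N la i) sd) big_mkcond /=.
apply: eq_bigr => i _; case: ifPn => //.
by rewrite -leqNgt => /row_len_ge.
Qed.

Lemma row_len_le_level la i : (row_len la i <= level la)%N.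
Proof.
have [lt|/row_len_ge ->//] := ltnP i (size la).
by rewrite (level_row_len (leqnn _)) (bigD1 (Ordinal lt)) //= leq_addr.
Qed.

Lemma size_le_level la : (size la <= level la)%N.
Proof.
rewrite (level_row_len (leqnn _)) -[leqLHS]card_ord -sum1_card.
by apply: leq_sum => i _; rewrite row_len_gt0.
Qed.

Lemma level_eq0 la : level la = 0%N -> la = empty_diagram.
Proof.
move=> l0; apply: row_len_ext => i; rewrite row_len_empty.
by apply/eqP; rewrite -leqn0 -l0 row_len_le_level.
Qed.

Lemma level_empty : level empty_diagram = 0%N. Proof. by []. Qed.

(** Containment of diagrams. *)
Definition sub_diagram (la mu : diagram) : bool := `[< forall i,
  (row_len la i <= row_len mu i)%N >].

Lemma level_sub la mu : sub_diagram la mu -> (level la <= level mu)%N.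
Proof.
move=> /asboolP sub; pose d := maxn (size la) (size mu).
rewrite (@level_row_len la d) ?leq_maxl // (@level_row_len mu d) ?leq_maxr //.
by apply: leq_sum.
Qed.

Lemma sub_level_eq la mu : sub_diagram la mu -> level la = level mu -> la = mu.
Proof.
move=> /asboolP sub; pose d := maxn (size la) (size mu).
rewrite (@level_row_len la d) ?leq_maxl // (@level_row_len mu d) ?leq_maxr // => E.
apply: row_len_ext => i; have [id|di] := ltnP i d; last first.
  by rewrite !row_len_ge // (leq_trans _ di) ?leq_maxl ?leq_maxr.
have := leqif_sum (fun (i : 'I_d) (_ : true) => leqif_eq (sub i)).
case=> _; rewrite E eqxx => /esym/forallP/(_ (Ordinal id))/eqP //.
Qed.

(** The diagrams with n cells, each listed once. They are found among the
    n-tuples of row lengths at most n, padded with zeros. *)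
Definition diagrams (n : nat) : seq diagram :=
  [seq la <- undup [seq diagram_of (nth 0%N [seq val x | x <- tval t]) n
                   | t <- enum {: n.-tuple 'I_n.+1}] | level la == n].

Lemma diagrams_uniq n : uniq (diagrams n).
Proof. by rewrite filter_uniq ?undup_uniq. Qed.

Lemma mem_diagrams n la : (la \in diagrams n) = (level la == n).
Proof.
rewrite mem_filter mem_undup andb_idr // => /eqP ln.
pose t := [tuple (inord (row_len la i) : 'I_n.+1) | i < n].
have E i : nth 0%N [seq val x | x <- tval t] i = row_len la i.
  have [lti|gei] := ltnP i n; last first.
    rewrite nth_default ?size_map -?enumT ?size_enum_ord //.
    by rewrite row_len_ge // (leq_trans (size_le_level _)) // ln.
  rewrite (nth_map ord0) ?size_tuple // (_ : nth _ _ _ = tnth t (Ordinal lti)).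
    by rewrite tnth_mktuple /= inordK // ltnS -ln row_len_le_level.
  by rewrite (tnth_nth ord0).
apply/mapP; exists t; first by rewrite mem_enum.
apply: row_len_ext => i; rewrite row_len_diagram_of ?E // => [j|].
  by rewrite !E row_len_anti.
by rewrite row_len_ge // -ln size_le_level.
Qed.

(** The diagrams with at most n cells, each listed once. *)
Definition diagrams_upto (n : nat) : seq diagram := flatten [seq diagrams j | j <- iota 0 n.+1].

Lemma mem_diagrams_upto n la : (la \in diagrams_upto n) = (level la <= n)%N.
Proof.
apply/flatten_mapP/idP => [[j]|le]; last by exists (level la); rewrite ?mem_iota ?mem_diagrams.
by rewrite mem_iota mem_diagrams add0n ltnS => /andP[_ ?] /eqP ->.
Qed.

Lemma diagrams_upto_uniq n : uniq (diagrams_upto n).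
Proof.
rewrite /diagrams_upto; elim: n => [|n IH]; first by rewrite /= cats0 diagrams_uniq.
rewrite -addn1 iotaD map_cat flatten_cat cat_uniq IH /= cats0 diagrams_uniq andbT.
apply/hasPn => la /=; rewrite add0n mem_diagrams => /eqP ln.
by rewrite -/(diagrams_upto n) mem_diagrams_upto ln ltnn.
Qed.

(** Reindexing of a sum over a list along a bijection between the selected
    elements, given by two mutually inverse maps. *)
Lemma sum_bij_seq (R : nmodType) (T T' : eqType) (s : seq T) (s' : seq T')
    (P : pred T) (P' : pred T') (F : T -> R) (F' : T' -> R)
    (f : T -> T') (g : T' -> T) :
  uniq s -> uniq s' ->
  (forall x, x \in s -> P x -> [/\ f x \in s', P' (f x) & g (f x) = x]) ->
  (forall y, y \in s' -> P' y -> [/\ g y \in s, P (g y) & f (g y) = y]) ->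
  (forall x, x \in s -> P x -> F x = F' (f x)) ->
  \sum_(x <- s | P x) F x = \sum_(y <- s' | P' y) F' y.
Proof.
move=> us us' fP gP FF'.
rewrite big_seq_cond (eq_bigr (fun x => F' (f x))); last first.
  by move=> x /andP[]; exact: FF'.
rewrite -big_seq_cond -!(big_filter s) -(big_filter s').
rewrite -(big_map f xpredT F'); apply: perm_big; apply: uniq_perm.
- rewrite map_inj_in_uniq ?filter_uniq // => x y.
  rewrite !mem_filter => /andP[Px xs] /andP[Py ys] E.
  by case: (fP x xs Px) => _ _ <-; rewrite E; case: (fP y ys Py).
- exact: filter_uniq.
move=> y; apply/mapP/idP => [[x]|]; rewrite mem_filter => /andP[Px xs].
  by move=> ->; case: (fP x xs Px) => ? ? _; rewrite mem_filter; apply/andP.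
by case: (gP y xs Px) => ? ? E; exists (g y); rewrite // mem_filter; apply/andP.
Qed.

Lemma sum_pick_seq (R : nmodType) (T : eqType) (s : seq T) (P : pred T) (F : T -> R) x :
  uniq s -> x \in s -> P x ->
  \sum_(i <- s | P i) F i = F x + \sum_(i <- s | P i && (i != x)) F i.
Proof.
move=> us xs Px; rewrite -big_filter (bigD1_seq x) ?filter_uniq ?mem_filter ?Px //=.
by rewrite big_filter_cond.
Qed.

(** * Cells and conjugation *)

Lemma ltn_inj m n : (forall j, (j < m)%N = (j < n)%N) -> m = n.
Proof.
move=> E; apply/eqP; rewrite eqn_leq; apply/andP; split; rewrite leqNgt; apply/negP.
  by rewrite E ltnn.
by rewrite -E ltnn.
Qed.

Lemma cells_ext la mu : (forall i j, (j < row_len la i)%N = (j < row_len mu i)%N) -> la = mu.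
Proof. by move=> E; apply: row_len_ext => i; exact: ltn_inj (E i). Qed.

Lemma ltn_count_iota (P : pred nat) b i : (forall i, P i.+1 -> P i) ->
  (i < count P (iota 0 b))%N = (i < b)%N && P i.
Proof.
move=> PS; have Ple m n : (m <= n)%N -> P n -> P m.
  by move=> mn; rewrite -(subnK mn); elim: (n - m)%N => [//|k IH] /PS.
elim: b => [|b IH]; first by rewrite ltn0.
rewrite -[X in iota 0 X]addn1 iotaD count_cat /= add0n addn0.
case Pb: (P b) => /=; last first.
  rewrite addn0 IH [in RHS]ltnS [in RHS]leq_eqVlt.
  by case: eqP => [->|//]; rewrite Pb !andbF.
suff -> : count P (iota 0 b) = b.
  by rewrite addn1 ltnS; case: leqP => //= ib; rewrite (Ple _ _ ib).
rewrite -[RHS](size_iota 0); apply/eqP; rewrite -all_count; apply/allP => j.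
by rewrite mem_iota add0n => /ltnW jb; exact: Ple Pb.
Qed.

(** The diagram whose cells are the pairs (i, j) satisfying P, for a predicate P
    closed downwards and contained in the box of size a by b. *)
Definition downset (P : nat -> nat -> bool) (a b : nat) : diagram :=
  diagram_of (fun i => count (P i) (iota 0 b)) a.

Lemma downsetE (P : nat -> nat -> bool) a b :
  (forall i j, P i.+1 j -> P i j) -> (forall i j, P i j.+1 -> P i j) ->
  (forall i j, P i j -> (i < a)%N && (j < b)%N) ->
  forall i j, (j < row_len (downset P a b) i)%N = P i j.
Proof.
move=> Pi Pj Pb i j; rewrite row_len_diagram_of.
- rewrite ltn_count_iota; last exact: Pj.
  by apply: andb_idl => /Pb/andP[].
- by move=> k; apply: sub_count => x; exact: Pi.
- apply/eqP; rewrite -leqn0 leqNgt -has_count; apply/hasPn => x _.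
  by apply/negP => /Pb; rewrite ltnn.
Qed.

Definition conj_diagram la : diagram :=
  downset (fun i j => (i < row_len la j)%N) (row_len la 0) (size la).

Lemma conj_diagramE la i j : (j < row_len (conj_diagram la) i)%N = (i < row_len la j)%N.
Proof.
rewrite downsetE // => {}i {}j h.
- exact: ltnW.
- exact: leq_trans h (row_len_anti _ _).
- by rewrite (leq_trans h) ?row_len_anti //= -row_len_gt0 (leq_trans _ h).
Qed.

Lemma conj_diagramK : involutive conj_diagram.
Proof. by move=> la; apply: cells_ext => i j; rewrite !conj_diagramE. Qed.

Lemma level_cells la a b : (size la <= a)%N -> (row_len la 0 <= b)%N ->
  level la = (\sum_(i < a) \sum_(j < b) (j < row_len la i))%N.
Proof.
move=> sa rb; rewrite (level_row_len sa); apply: eq_bigr => i _.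
have le : (row_len la i <= b)%N by apply: leq_trans rb; exact: row_len_anti.
rewrite -[LHS]card_ord -sum1_card (big_ord_widen b (fun=> 1%N)) //.
by rewrite big_mkcond /=; apply: eq_bigr => j _; case: ifP.
Qed.

Lemma size_conj_diagram la : size (conj_diagram la) = row_len la 0.
Proof. by apply: ltn_inj => i; rewrite -row_len_gt0 conj_diagramE. Qed.

Lemma level_conj_diagram la : level (conj_diagram la) = level la.
Proof.
have E : row_len (conj_diagram la) 0 = size la by rewrite -{2}(conj_diagramK la)
  size_conj_diagram.
rewrite (@level_cells _ (row_len la 0) (size la)) ?size_conj_diagram ?E //.
rewrite exchange_big (@level_cells la (size la) (row_len la 0)) //=.
by apply: eq_bigr => i _; apply: eq_bigr => j _; rewrite conj_diagramE.
Qed.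

(** * Horizontal and vertical strips *)

(** [strip true nu mu] means that mu/nu is a horizontal strip (at most one cell
    per column), [strip false nu mu] that it is a vertical strip (at most one
    cell per row). A column of mu/nu has at most one cell exactly when each row
    of mu is no longer than the row of nu above it. *)
Definition strip (b : bool) nu mu : bool :=
  `[< forall i, (row_len nu i <= row_len mu i)%N /\
      (if b then row_len mu i.+1 <= row_len nu i else row_len mu i <= (row_len nu i).+1)%N >].

Lemma strip_sub b nu mu : strip b nu mu -> sub_diagram nu mu.
Proof. by move=> /asboolP s; apply/asboolP => i; case: (s i). Qed.

Lemma strip_level b nu mu : strip b nu mu -> (level nu <= level mu)%N.
Proof. by move=> /strip_sub/level_sub. Qed.

Lemma strip_refl b nu : strip b nu nu.
Proof. by apply/asboolP => i; split=> //; case: b => //; exact: row_len_anti. Qed.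

Lemma strip_level_eq b nu mu : strip b nu mu -> level nu = level mu -> nu = mu.
Proof. by move=> /strip_sub/sub_level_eq. Qed.

Lemma leq_ltnP m n : reflect (forall j, j < m -> j < n)%N (m <= n)%N.
Proof.
apply: (iffP idP) => [mn j jm|h]; first exact: leq_trans jm mn.
by case: m h => [//|m]; exact.
Qed.

Lemma strip_conj b nu mu : strip b (conj_diagram nu) (conj_diagram mu) = strip (~~ b) nu mu.
Proof.
suff H b' nu' mu' : strip b' nu' mu' -> strip (~~ b') (conj_diagram nu') (conj_diagram mu').
  by apply/idP/idP => /H; rewrite ?negbK ?conj_diagramK.
move=> /asboolP s; apply/asboolP => i; split.
  by apply/leq_ltnP => j; rewrite !conj_diagramE => /leq_trans; apply; case: (s j).
case: b' s => s /=; apply/leq_ltnP => j; rewrite ?ltnS ?conj_diagramE.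
  case: j => // j h; rewrite conj_diagramE (leq_trans h) //; case: (s j) => _.
  by [].
by move=> h; rewrite -ltnS (leq_trans h) //; case: (s j).
Qed.

Lemma sum_leq_eq (f g : nat -> nat) d : (forall i, f i <= g i)%N ->
  (\sum_(i < d) f i = \sum_(i < d) g i)%N -> forall i, (i < d)%N -> f i = g i.
Proof.
move=> fg E i id.
have := leqif_sum (fun (i : 'I_d) (_ : true) => leqif_eq (fg i)).
by case=> _; rewrite E eqxx => /esym/forallP/(_ (Ordinal id))/eqP.
Qed.

(** An edge of the Young graph is a strip with one cell. *)
Lemma young_edgeE la mu :
  young_edge la mu = strip true la mu && (level mu == (level la).+1).
Proof.
apply/existsP/andP => [[i /eqP E]|[/asboolP s /eqP l]].
  have E' j : row_len mu j = ((i == j :> nat) + row_len la j)%N.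
    by rewrite /row_len E nth_incr_nth.
  split; last by rewrite /level E sumn_incr_nth.
  apply/asboolP => j; rewrite E' leq_addl; split=> //.
  have := row_len_anti mu (leqnSn j); rewrite !E'.
  have := row_len_anti la (leqnSn j).
  by case: (i =P j :> nat) => [->|]; case: (i =P j.+1 :> nat); lia.
(* Conversely, let i be a row in which mu is longer: comparing levels, it is
   longer there by one cell and nowhere else. *)
have [i lti] : exists i, (row_len la i < row_len mu i)%N.
  apply: contrapT => /forallNP h.
  have : sub_diagram mu la by apply/asboolP => i; rewrite leqNgt; apply/negP.
  by move=> /level_sub; rewrite l ltnn.
have lei : (i < (size la).+1)%N.
  rewrite ltnS leqNgt; apply/negP; case: i lti => // i lti.
  rewrite ltnS => /row_len_ge E; case: (s i) => _; rewrite E leqn0 => /eqP E'.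
  by rewrite E' in lti.
pose f j := ((i == j) + row_len la j)%N.
pose d := maxn (size la).+1 (size mu).
have fE j : (j < d)%N -> row_len mu j = f j.
  move=> jd; apply/esym; move: j jd; apply: sum_leq_eq => [j|].
    by rewrite /f; case: eqP => [<-//|_]; case: (s j).
  have id : (i < d)%N by rewrite (leq_trans lei) ?leq_maxl.
  rewrite big_split /= -(level_row_len (ltnW _)) ?leq_maxl // (bigD1 (Ordinal id)) //=.
  rewrite eqxx big1 => [|j /negPf ji]; last by rewrite eq_sym -val_eqE /= in ji; rewrite ji.
  by rewrite addn0 add1n -l (@level_row_len mu d) // leq_maxr.
have gt0 j : (j < size mu)%N = (i == j) || (j < size la)%N.
  have [jd|dj] := ltnP j d; first by rewrite -!row_len_gt0 fE // /f; case: eqP.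
  move: dj; rewrite /d geq_max => /andP[lj mj].
  by rewrite (ltnNge _ (size mu)) mj (ltnNge _ (size la)) (ltnW lj) orbF;
    apply/esym/negP => /eqP E; rewrite -E in lj; lia.
have sz : size mu = size (incr_nth la i).
  apply: ltn_inj => j; rewrite gt0 size_incr_nth.
  case: (ltnP i (size la)) => h; case: (i =P j) => [<-|ne] /=; rewrite ?h ?ltnSn //.
  by apply/idP/idP; lia.
exists (Ordinal lei); apply/eqP/(@eq_from_nth _ 0%N) => //= j js.
by rewrite nth_incr_nth -/(row_len la j) -/(f j) -fE // (leq_trans js) ?leq_maxr.
Qed.

(** When la, mu, rho are the ends of two consecutive horizontal strips, the
    length of row i of mu ranges over the interval [reflect_lo i, reflect_hi i],
    independently of the other rows. *)
Definition reflect_lo la rho i := maxn (row_len la i) (row_len rho i.+1).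
Definition reflect_hi la rho i := if i is i'.+1 then minn (row_len la i') (row_len rho i) else
  row_len rho 0.
(** The involution that reflects every row length of mu in its interval, as in
    the proof of Bender and Knuth that Schur functions are symmetric. *)
Definition hreflect la rho mu : diagram :=
  diagram_of (fun i => reflect_lo la rho i + reflect_hi la rho i - row_len mu i)%N (size
    rho).+1.

Lemma between_strips la rho mu : strip true la mu -> strip true mu rho ->
  forall i, (reflect_lo la rho i <= row_len mu i <= reflect_hi la rho i)%N.
Proof.
move=> /asboolP s1 /asboolP s2 i; rewrite /reflect_lo /reflect_hi geq_max.
case: (s1 i) (s2 i) => -> _ [ri ->] /=; case: i ri => [|i] ri //.
by rewrite leq_min ri andbT; case: (s1 i).
Qed.

Lemma row_len_hreflect la rho mu : strip true la mu -> strip true mu rho ->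
  row_len (hreflect la rho mu) =1 (fun i =>
    reflect_lo la rho i + reflect_hi la rho i - row_len mu i)%N.
Proof.
move=> s1 s2; have B := between_strips s1 s2.
apply: row_len_diagram_of => [i|].
  have := B i; have := B i.+1; rewrite /reflect_lo /=; lia.
have := B (size rho).+1; rewrite /reflect_lo /reflect_hi.
by rewrite !(@row_len_ge rho) // ?(leq_trans _ (leqnSn _)) //; lia.
Qed.

Lemma hreflect_strip la rho mu : strip true la mu -> strip true mu rho ->
  strip true la (hreflect la rho mu) /\ strip true (hreflect la rho mu) rho.
Proof.
move=> s1 s2; have B := between_strips s1 s2.
have rE := row_len_hreflect s1 s2.
split; apply/asboolP => i; rewrite !rE; have := B i; have := B i.+1.
  by rewrite /reflect_lo /=; lia.
by rewrite /reflect_lo; case: i => [|i] /=; lia.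
Qed.

Lemma hreflectK la rho mu : strip true la mu -> strip true mu rho ->
  hreflect la rho (hreflect la rho mu) = mu.
Proof.
move=> s1 s2; have B := between_strips s1 s2; case: (hreflect_strip s1 s2) => s3 s4.
by apply: row_len_ext => i; rewrite !row_len_hreflect //; have := B i; lia.
Qed.

Lemma sum_reflect_lo_hi la rho d :
  (\sum_(i < d.+1) (reflect_lo la rho i + reflect_hi la rho i) =
   \sum_(i < d) row_len la i + \sum_(i < d.+1) row_len rho i + reflect_lo la rho d)%N.
Proof.
elim: d => [|d IH]; first by rewrite !big_ord_recr !big_ord0 /=; lia.
rewrite big_ord_recr IH /=; set A := (\sum_(i < d.+1) row_len rho i)%N.
have -> : (\sum_(i < d.+2) row_len rho i = A + row_len rho d.+1)%N by rewrite big_ord_recr.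
have -> : (\sum_(i < d.+1) row_len la i = \sum_(i < d) row_len la i + row_len la d)%N.
  by rewrite big_ord_recr.
rewrite /reflect_lo; have := addn_min_max (row_len la d) (row_len rho d.+1).
move: A (\sum_(i < d) row_len la i)%N (row_len la d) (row_len rho d.+1) (maxn (row_len la d.+1)
  _) => A B a b c.
move: (minn a b) (maxn a b) => m M; lia.
Qed.

Lemma level_hreflect la rho mu : strip true la mu -> strip true mu rho ->
  (level (hreflect la rho mu) + level mu = level la + level rho)%N.
Proof.
move=> s1 s2; have B := between_strips s1 s2; case: (hreflect_strip s1 s2) => s3 s4.
pose d := (maxn (size la) (size rho)).
have sl : (size la <= d)%N by rewrite leq_maxl.
have sr : (size rho <= d)%N by rewrite leq_maxr.
have sub_size nu : sub_diagram nu rho -> (size nu <= d.+1)%N.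
  move=> /asboolP sub; rewrite (leq_trans _ (leq_trans sr _)) //.
  by apply/leq_ltnP => i; rewrite -!row_len_gt0 => /leq_trans; apply.
rewrite (level_row_len (sub_size _ (strip_sub s4))) (level_row_len (sub_size _ (strip_sub s2))).
rewrite -big_split /= (eq_bigr (fun i : 'I_d.+1 =>
  reflect_lo la rho i + reflect_hi la rho i)%N).
  rewrite sum_reflect_lo_hi (level_row_len sl) (@level_row_len rho d.+1) ?(leq_trans sr) //.
  by rewrite /reflect_lo !row_len_ge // ?(leq_trans sr) // addn0.
by move=> i _; rewrite row_len_hreflect //; have := B i; lia.
Qed.

(** The same involution for either kind of strip. *)
Definition strip_reflect b la rho mu :=
  if b then hreflect la rho mu else conj_diagram (hreflect (conj_diagram la) (conj_diagram rho)
    (conj_diagram mu)).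

(** The reflection exchanges the sizes of the two strips. *)
Lemma strip_reflectP b la rho mu : strip b la mu -> strip b mu rho ->
  [/\ strip b la (strip_reflect b la rho mu), strip b (strip_reflect b la rho mu) rho,
     (level (strip_reflect b la rho mu) + level mu = level la + level rho)%N &
     strip_reflect b la rho (strip_reflect b la rho mu) = mu].
Proof.
case: b => s1 s2 /=.
  by case: (hreflect_strip s1 s2); rewrite level_hreflect // hreflectK.
rewrite -(strip_conj true) in s1; rewrite -(strip_conj true) in s2.
case: (hreflect_strip s1 s2) => s3 s4.
rewrite -!(strip_conj true) !conj_diagramK hreflectK // conj_diagramK level_conj_diagram.
by have := level_hreflect s1 s2; rewrite !level_conj_diagram.
Qed.

(** * Strip operators *)

(** The sum of phi over all mu such that mu/la is a strip with m cells. For phi a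
    linear functional on symmetric functions in the Schur basis, this is phi at
    the product of s_la with a complete (b true) or elementary (b false)
    symmetric function of degree m. *)
Definition strip_up (R : nmodType) b m (phi : diagram -> R) la : R :=
  \sum_(mu <- diagrams (level la + m) | strip b la mu) phi mu.

(** The sum of f over all nu such that la/nu is a strip, weighted by x to the
    number of cells of the strip: the branching rule for one more variable x. *)
Definition strip_down (R : pzRingType) b (x : R) (f : diagram -> R) la : R :=
  \sum_(nu <- diagrams_upto (level la) | strip b nu la) x ^+ (level la - level nu) * f nu.

Lemma strip_up_up (R : nmodType) b m n (phi : diagram -> R) la :
  strip_up b m (strip_up b n phi) la = \sum_(rho <- diagrams (level la + m + n))
    \sum_(mu <- diagrams (level la + m) | strip b la mu && strip b mu rho) phi rho.
Proof.
rewrite /strip_up (exchange_big_dep (strip b la)) /=; last by move=> ? ? _ /andP[].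
rewrite big_seq_cond [RHS]big_seq_cond; apply: eq_bigr => mu /andP[].
by rewrite mem_diagrams => /eqP -> ->.
Qed.

Lemma strip_up_comm (R : nmodType) b m n (phi : diagram -> R) la :
  strip_up b m (strip_up b n phi) la = strip_up b n (strip_up b m phi) la.
Proof.
rewrite !strip_up_up -!addnA [(n + m)%N]addnC !addnA.
rewrite big_seq [RHS]big_seq; apply: eq_bigr => rho; rewrite mem_diagrams => /eqP lr.
have H m' n' mu : (m' + n' = m + n)%N -> mu \in diagrams (level la + m') ->
    strip b la mu && strip b mu rho ->
    [/\ strip_reflect b la rho mu \in diagrams (level la + n'),
       strip b la (strip_reflect b la rho mu) && strip b (strip_reflect b la rho mu) rho &
       strip_reflect b la rho (strip_reflect b la rho mu) = mu].
  rewrite !mem_diagrams => E /eqP lm /andP[s1 s2].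
  case: (strip_reflectP s1 s2) => -> -> + ->; split=> //; apply/eqP; lia.
apply: (@sum_bij_seq _ _ _ _ _ _ _ _ _ (strip_reflect b la rho) (strip_reflect b la rho)).
- exact: diagrams_uniq.
- exact: diagrams_uniq.
- by move=> mu; apply: H.
- by move=> mu; apply: H; rewrite addnC.
- by [].
Qed.

Lemma strip_down_down (R : comPzRingType) b (x y : R) (f : diagram -> R) rho :
  strip_down b x (strip_down b y f) rho = \sum_(la <- diagrams_upto (level rho))
   \sum_(mu <- diagrams_upto (level rho) | strip b la mu && strip b mu rho)
     x ^+ (level rho - level mu) * y ^+ (level mu - level la) * f la.
Proof.
rewrite (exchange_big_dep (fun mu => strip b mu rho)) /=; last by move=> ? ? _ /andP[].
rewrite /strip_down big_seq_cond [RHS]big_seq_cond; apply: eq_bigr => mu /andP[].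
rewrite mem_diagrams_upto => lm ->; rewrite big_distrr /=.
under [RHS]eq_bigl do rewrite andbT.
under [RHS]eq_bigr do rewrite -mulrA.
apply: (@sum_bij_seq _ _ _ _ _ _ _ _ _ id id); rewrite ?diagrams_upto_uniq // => la;
  rewrite !mem_diagrams_upto.
  by move=> l s; split=> //; exact: leq_trans lm.
by move=> l s; split=> //; exact: strip_level s.
Qed.

Lemma strip_down_comm (R : comPzRingType) b (x y : R) (f : diagram -> R) rho :
  strip_down b x (strip_down b y f) rho = strip_down b y (strip_down b x f) rho.
Proof.
rewrite !strip_down_down big_seq [RHS]big_seq; apply: eq_bigr => la;
  rewrite mem_diagrams_upto => lr.
have H mu : mu \in diagrams_upto (level rho) ->
    strip b la mu && strip b mu rho ->
    [/\ strip_reflect b la rho mu \in diagrams_upto (level rho),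
       strip b la (strip_reflect b la rho mu) && strip b (strip_reflect b la rho mu) rho &
       strip_reflect b la rho (strip_reflect b la rho mu) = mu].
  rewrite !mem_diagrams_upto => lm /andP[s1 s2].
  by case: (strip_reflectP s1 s2) => -> s3 _ ->; rewrite s3 (strip_level s3).
apply: (@sum_bij_seq _ _ _ _ _ _ _ _ _ (strip_reflect b la rho) (strip_reflect b la rho)) =>
  //; rewrite ?diagrams_upto_uniq //.
move=> mu _ /andP[s1 s2]; case: (strip_reflectP s1 s2) => s3 s4 E _.
have := strip_level s1; have := strip_level s2; have := strip_level s3; have := strip_level s4.
move=> *; rewrite [_ * y ^+ _]mulrC; congr (y ^+ _ * x ^+ _ * _); lia.
Qed.

Lemma strip_up_conj (R : nmodType) b m (phi : diagram -> R) la :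
  strip_up b m (phi \o conj_diagram) la = strip_up (~~ b) m phi (conj_diagram la).
Proof.
apply: (@sum_bij_seq _ _ _ _ _ _ _ _ _ conj_diagram conj_diagram);
  rewrite ?diagrams_uniq //= => mu; rewrite !mem_diagrams !level_conj_diagram.
  by move=> -> s; rewrite strip_conj negbK conj_diagramK.
by move=> -> s; rewrite -(negbK b) -strip_conj conj_diagramK.
Qed.

Lemma strip_down_conj (R : pzRingType) b (x : R) (f : diagram -> R) la :
  strip_down b x (f \o conj_diagram) la = strip_down (~~ b) x f (conj_diagram la).
Proof.
apply: (@sum_bij_seq _ _ _ _ _ _ _ _ _ conj_diagram conj_diagram);
  rewrite ?diagrams_upto_uniq //= => mu; rewrite !mem_diagrams_upto !level_conj_diagram.
- by move=> -> s; rewrite strip_conj negbK conj_diagramK.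
- by move=> -> s; rewrite -(negbK b) -strip_conj conj_diagramK.
- by [].
Qed.

(** * Adding and removing a first row *)

(** The diagram la with a row of length r put on top; r must be at least the
    first row of la. *)
Definition cons_row r la : diagram :=
  diagram_of (fun i => if i is j.+1 then row_len la j else r) (size la).+1.
(** The diagram mu without its first row. *)
Definition behead_row mu : diagram := diagram_of (fun i => row_len mu i.+1) (size mu).
(** The diagram with a single row of r cells. *)
Definition row_shape r := cons_row r empty_diagram.

Lemma row_len_cons_row r la : (row_len la 0 <= r)%N ->
  row_len (cons_row r la) =1 (fun i => if i is j.+1 then row_len la j else r).
Proof.
by move=> lr; apply: row_len_diagram_of => [[|i]|]; rewrite ?row_len_size // row_len_anti.
Qed.

Lemma row_len_behead_row mu i : row_len (behead_row mu) i = row_len mu i.+1.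
Proof. by rewrite row_len_diagram_of => [//|j|]; rewrite ?row_len_anti // row_len_ge. Qed.

Lemma behead_row_cons_row r la : (row_len la 0 <= r)%N -> behead_row (cons_row r la) = la.
Proof. by move=> lr; apply: row_len_ext => i; rewrite row_len_behead_row row_len_cons_row. Qed.

Lemma cons_row_behead_row mu : cons_row (row_len mu 0) (behead_row mu) = mu.
Proof.
apply: row_len_ext => i; rewrite row_len_cons_row ?row_len_behead_row ?row_len_anti //.
by case: i => // i; rewrite row_len_behead_row.
Qed.

Lemma level_behead_row mu : level mu = (row_len mu 0 + level (behead_row mu))%N.
Proof.
rewrite (@level_row_len mu (size mu).+1) ?leqnSn // big_ord_recl; congr addn.
rewrite (@level_row_len _ (size mu)); first by apply: eq_bigr => i _;
  rewrite row_len_behead_row.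
apply/leq_ltnP => i; rewrite -!row_len_gt0 row_len_behead_row => /leq_trans; apply.
exact: row_len_anti.
Qed.

Lemma level_cons_row r la : (row_len la 0 <= r)%N -> level (cons_row r la) = (r + level la)%N.
Proof. by move=> lr; rewrite level_behead_row behead_row_cons_row // row_len_cons_row. Qed.

(** For r at least the first row of la, mu is obtained from la by adding a
    horizontal strip of size r exactly when la is obtained by adding a
    horizontal strip to the lower rows of mu. *)
Lemma strip_up_row (R : nmodType) (phi : diagram -> R) la r : (row_len la 0 <= r)%N ->
  strip_up true r phi la = \sum_(nu <- diagrams_upto (level la) | strip true nu la)
     phi (cons_row (r + (level la - level nu)) nu).
Proof.
move=> lr; apply: (@sum_bij_seq _ _ _ _ _ _ _ _ _ behead_row
    (fun nu => cons_row (r + (level la - level nu)) nu)).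
- exact: diagrams_uniq.
- exact: diagrams_upto_uniq.
- move=> mu; rewrite mem_diagrams => /eqP lm /asboolP s.
  have st : strip true (behead_row mu) la.
    by apply/asboolP => i; rewrite !row_len_behead_row; case: (s i) (s i.+1) => _ -> [-> _].
  rewrite st mem_diagrams_upto (strip_level st); split=> //.
  rewrite -[RHS]cons_row_behead_row; congr cons_row.
  have := level_behead_row mu; have := strip_level st; lia.
- move=> nu; rewrite mem_diagrams_upto => ln /[dup] st /asboolP s.
  have ge : (row_len nu 0 <= r + (level la - level nu))%N.
    by rewrite (leq_trans _ (leq_addr _ _)) // (leq_trans _ lr) //; case: (s 0%N).
  rewrite mem_diagrams level_cons_row // behead_row_cons_row //; split=> //;
    first by apply/eqP; lia.
  apply/asboolP => -[|i]; rewrite !row_len_cons_row //.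
    by split; [rewrite (leq_trans lr) // leq_addr|case: (s 0%N)].
  by case: (s i.+1) (s i) => ? _ [_ ?].
- move=> mu; rewrite mem_diagrams => /eqP lm /asboolP s.
  have st : strip true (behead_row mu) la.
    by apply/asboolP => i; rewrite !row_len_behead_row; case: (s i) (s i.+1) => _ -> [-> _].
  congr phi; rewrite -[LHS]cons_row_behead_row; congr cons_row.
  have := level_behead_row mu; have := strip_level st; lia.
Qed.

Lemma sub_row_len_level la mu i : sub_diagram la mu ->
  (row_len mu i + level la <= row_len la i + level mu)%N.
Proof.
move=> /asboolP s; pose d := maxn i.+1 (maxn (size la) (size mu)).
have id : (i < d)%N by rewrite leq_maxl.
rewrite (@level_row_len la d) ?(leq_trans (leq_maxl _ _) (leq_maxr _ _)) //.
rewrite (@level_row_len mu d) ?(leq_trans (leq_maxr _ _) (leq_maxr _ _)) //.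
rewrite (bigD1 (Ordinal id)) //= [X in (_ <= _ + X)%N](bigD1 (Ordinal id)) //=.
have : (\sum_(j < d | j != Ordinal id) row_len la j <= \sum_(j < d | j != Ordinal id) row_len
  mu j)%N.
  by apply: leq_sum => j _.
by rewrite addnCA !leq_add2l.
Qed.

Lemma strip_behead_row b la r rho : (row_len la 0 <= r)%N -> strip b (cons_row r la) rho ->
  [/\ strip b la (behead_row rho), (r <= row_len rho 0)%N & b || (row_len rho 0 <= r.+1)%N].
Proof.
move=> lr /asboolP s; split.
- by apply/asboolP => i; have := s i.+1; rewrite !row_len_behead_row !row_len_cons_row.
- by have := s 0%N; rewrite !row_len_cons_row // => -[].
- by have := s 0%N; rewrite !row_len_cons_row // => -[_]; case: b {s}.
Qed.

(** Strips added to a diagram with a long first row: a cells extend the first row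
    (at most one if the strip is vertical) and the other ones form a strip
    below, without interaction. *)
Lemma strip_up_cons_row (R : nmodType) b m (phi : diagram ->
  R) la r : (row_len la 0 + m <= r)%N ->
  strip_up b m phi (cons_row r la) =
  \sum_(a < m.+1 | b || (a <= 1)%N) strip_up b (m - a) (fun mu => phi (cons_row (r + a) mu)) la.
Proof.
move=> lmr; have lr : (row_len la 0 <= r)%N by rewrite (leq_trans _ lmr) // leq_addr.
(* The diagrams are sorted by the number a of cells added to the first row. *)
rewrite [LHS](partition_big (fun rho => inord (row_len rho 0 - r) : 'I_m.+1) xpredT) //=.
rewrite [RHS]big_mkcond; apply: eq_bigr => a _.
have inE rho : rho \in diagrams (level (cons_row r la) + m) -> strip b (cons_row r la) rho ->
    inord (row_len rho 0 - r) == a -> row_len rho 0 = (r + a)%N.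
  rewrite mem_diagrams level_cons_row // => /eqP lrho s /eqP <-.
  case: (strip_behead_row lr s) => st ge _; have := strip_level st.
  have := level_behead_row rho; rewrite lrho => E le.
  by rewrite inordK ?subnKC //; lia.
case: ifPn => [ab|nab]; last first.
  rewrite big_seq_cond big1 // => rho /andP[rp /andP[s i]].
  have := inE rho rp s i; case: (strip_behead_row lr s) => _ _ + E.
  rewrite E; case: b nab {s rp i inE E} => //=; lia.
have am : (a <= m)%N by rewrite -ltnS.
apply: (@sum_bij_seq _ _ _ _ _ _ _ _ _ behead_row (cons_row (r + a))).
- exact: diagrams_uniq.
- exact: diagrams_uniq.
- move=> rho rp /andP[s i]; have E := inE _ rp s i.
  case: (strip_behead_row lr s) => st _ _; rewrite st -E cons_row_behead_row; split=> //.
  move: rp; rewrite !mem_diagrams level_cons_row // => /eqP lrho; apply/eqP.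
  by have := level_behead_row rho; lia.
- move=> mu; rewrite !mem_diagrams (level_cons_row lr) => /eqP lmu s.
  have mr : (row_len mu 0 <= r)%N.
    by have := sub_row_len_level 0 (strip_sub s); rewrite lmu; lia.
  have mra : (row_len mu 0 <= r + a)%N by rewrite (leq_trans mr) ?leq_addr.
  rewrite level_cons_row // behead_row_cons_row // row_len_cons_row // addKn inord_val eqxx
    andbT.
  split=> //; first by apply/eqP; lia.
  move/asboolP: s => s; apply/asboolP => -[|i]; rewrite !row_len_cons_row //; split; first lia.
  by case: b ab {inE s} => //=; lia.
- move=> rho rp /andP[s i]; have E := inE _ rp s i.
  by rewrite -E cons_row_behead_row.
Qed.

Lemma diagrams_upto0 : diagrams_upto 0 = [:: empty_diagram].
Proof.
apply: perm_small_eq => //; apply: uniq_perm; rewrite ?diagrams_upto_uniq // => la.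
by rewrite mem_diagrams_upto leqn0 inE; apply/eqP/eqP => [/level_eq0//|->].
Qed.

Lemma strip_up_empty_row (R : nmodType) (phi : diagram -> R) r :
  strip_up true r phi empty_diagram = phi (row_shape r).
Proof.
by rewrite strip_up_row ?row_len_empty // diagrams_upto0 big_cons big_nil strip_refl addr0
  subnn addn0.
Qed.

(** The diagram with a single column of r cells. *)
Definition col_shape r := conj_diagram (row_shape r).

Lemma conj_diagram_empty : conj_diagram empty_diagram = empty_diagram.
Proof. by apply: level_eq0; rewrite level_conj_diagram. Qed.

Lemma level_row_shape r : level (row_shape r) = r.
Proof. by rewrite level_cons_row ?row_len_empty // level_empty addn0. Qed.

Lemma row_len_row_shape r i : row_len (row_shape r) i = if i is 0%N then r else 0%N.
Proof. by rewrite row_len_cons_row ?row_len_empty //; case: i => // i;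
  rewrite row_len_empty. Qed.

(** The indicator function of the empty diagram. *)
Definition delta (R : pzRingType) la : R := (la == empty_diagram)%:R.

(** * Peeling off the Thoma parameters *)

Lemma cvgn_sum (R : realType) (T : eqType) (s : seq T) (P : pred T)
    (u : T -> nat -> R) (l : T -> R) :
  (forall x, x \in s -> P x -> u x n @[n --> \oo] --> l x) ->
  \sum_(x <- s | P x) u x n @[n --> \oo] --> \sum_(x <- s | P x) l x.
Proof.
elim: s => [|x s IH] h.
  rewrite big_nil; under eq_fun do rewrite big_nil.
  exact: cvg_cst.
rewrite big_cons; under eq_fun do rewrite big_cons.
have hs : \sum_(y <- s | P y) u y n @[n --> \oo] --> \sum_(y <- s | P y) l y.
  by apply: IH => y ys; apply: h; rewrite inE ys orbT.
case: ifP => Px; last exact: hs.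
by apply: cvgD => //; apply: h => //; rewrite mem_head.
Qed.

Lemma cvgn_eventually_eq (R : realType) (u v : nat -> R) (l : R) N :
  (forall n, (N <= n)%N -> u n = v n) -> u n @[n --> \oo] --> l -> v n @[n --> \oo] --> l.
Proof.
move=> E; apply: cvg_trans; apply: near_eq_cvg.
by near=> n; apply: E; near: n; exact: nbhs_infty_ge.
Unshelve. all: by end_near. Qed.

Lemma cvgn_unique (R : realType) (u : nat -> R) (l l' : R) :
  u n @[n --> \oo] --> l -> u n @[n --> \oo] --> l' -> l = l'.
Proof. exact: cvg_unique. Qed.

Lemma cvgn_ge0 (R : realType) (u : nat -> R) (l : R) N :
  (forall n, (N <= n)%N -> 0 <= u n) -> u n @[n --> \oo] --> l -> 0 <= l.
Proof.
move=> h ul; have <- : limn u = l by apply: cvg_lim.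
apply: limr_ge; first by apply/cvg_ex; exists l.
by near=> n; apply: h; near: n; exact: nbhs_infty_ge.
Unshelve. all: by end_near. Qed.

Lemma cvgn_shift (R : realType) (u : nat -> R) (l : R) j :
  u n @[n --> \oo] --> l -> u (n + j)%N @[n --> \oo] --> l.
Proof. by move=> c; rewrite (cvg_shiftn j u (nbhs l)). Qed.


(** Pieri rules: phi is an eigenfunction of all the operators [strip_up b m]. *)
Definition pieri (R : realType) (phi : diagram -> R) :=
  forall b m la, strip_up b m phi la = strip_up b m phi empty_diagram * phi la.

(** The properties of phi that are preserved when a parameter is peeled off. *)
Definition positive_pieri (R : realType) (phi : diagram -> R) :=
  [/\ forall la, 0 <= phi la, phi empty_diagram = 1 & pieri phi].

(** The function phi vanishes on the diagrams outside the (k, l)-hook. *)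
Definition hook_supported (R : realType) k l (phi : diagram -> R) :=
  forall la, ~~ in_hook k l la -> phi la = 0.

Lemma positive_pieri_conj (R : realType) (phi : diagram -> R) : positive_pieri phi ->
  positive_pieri (phi \o conj_diagram).
Proof.
move=> [ge0 one pi]; split=> [la||b m la] /=; rewrite ?conj_diagram_empty //.
by rewrite !strip_up_conj pi conj_diagram_empty.
Qed.

Lemma in_hook_conj k l la : in_hook k l (conj_diagram la) = in_hook l k la.
Proof. by rewrite /in_hook leqNgt -/(row_len _ _) conj_diagramE -leqNgt. Qed.

Lemma hook_supported_conj (R : realType) k l (phi : diagram -> R) :
  hook_supported k l phi -> hook_supported l k (phi \o conj_diagram).
Proof. by move=> h la; rewrite -in_hook_conj => /h. Qed.

Lemma strip_up_ge (R : realType) (phi : diagram -> R) b m la mu :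
  (forall la, 0 <= phi la) -> strip b la mu -> level mu = (level la + m)%N ->
  phi mu <= strip_up b m phi la.
Proof.
move=> ge0 s l; rewrite /strip_up (sum_pick_seq _ (diagrams_uniq _) _ s) ?mem_diagrams ?l //=.
by rewrite lerDl sumr_ge0.
Qed.

(** By the Pieri rule both sides are sums of phi over diagrams with 2n + 2 cells,
    and every diagram counted on the left is counted on the right. *)
Lemma row_log_concave (R : realType) (phi : diagram -> R) n : positive_pieri phi ->
  phi (row_shape n.+2) * phi (row_shape n) <= phi (row_shape n.+1) * phi (row_shape n.+1).
Proof.
move=> [ge0 one pi]; rewrite mulrC -!(strip_up_empty_row phi n) -{1}(strip_up_empty_row phi
  n.+1) -!pi.
rewrite /strip_up !level_row_shape (_ : n.+2 + n = n.+1 + n.+1)%N; last by lia.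
rewrite big_mkcond [leRHS]big_mkcond big_seq [leRHS]big_seq; apply: ler_sum => mu.
rewrite mem_diagrams => /eqP lm.
case: ifPn => [s|_]; last by case: ifP.
suff -> : strip true (row_shape n.+1) mu by [].
move/asboolP: s => s; apply/asboolP => i.
have := s i; have := level_behead_row mu; have := row_len_le_level (behead_row mu) 0.
rewrite row_len_behead_row !row_len_row_shape lm; case: i => //= lt E [h _].
by split; lia.
Qed.

Lemma row_ratio_cvg (R : realType) (phi : diagram -> R) (h := fun n => phi (row_shape n)) :
  positive_pieri phi -> (forall n, 0 < h n) -> exists2 al : R, 0 <= al &
  forall j, h (n + j)%N / h n @[n --> \oo] --> al ^+ j.
Proof.
move=> gphi hpos; pose q n := h n.+1 / h n.
have q0 n : 0 <= q n by rewrite divr_ge0 // ltW ?hpos.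
have qS n : q n.+1 <= q n.
  rewrite ler_pdivrMr ?hpos // mulrAC ler_pdivlMr ?hpos //.
  exact: row_log_concave.
have qc : cvgn q.
  apply: nonincreasing_is_cvgn; first exact/nonincreasing_seqP.
  by exists 0 => _ [n _ <-].
exists (limn q); first by apply: (@cvgn_ge0 _ q _ 0).
elim=> [|j IH].
  rewrite expr0; apply: (@cvgn_eventually_eq _ (fun=> 1) _ _ 0) => [n _|]; last exact: cvg_cst.
  by rewrite addn0 divff // gt_eqF ?hpos.
rewrite exprS; apply: (@cvgn_eventually_eq _ (fun n =>
  q (n + j)%N * (h (n + j)%N / h n)) _ _ 0).
  move=> n _; rewrite /q addnS mulrA mulfVK // gt_eqF //; exact: hpos.
apply: cvgM => //.
exact: cvgn_shift qc.
Qed.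

(** Removal of one parameter: alpha is the limit of the ratios h_(n+1) / h_n of
    the values at one-row diagrams, and phi'(la) the limit of the quotients
    phi(n, la) / h_n. *)
Lemma peel_row (R : realType) (phi : diagram -> R) :
  positive_pieri phi -> (forall n, 0 < phi (row_shape n)) -> exists al (phi' : diagram -> R),
    [/\ 0 <= al, positive_pieri phi',
   phi = strip_down true al phi' &
   forall k l, hook_supported k.+1 l phi -> hook_supported k l phi'].
Proof.
move=> gphi hpos; have [ge0 one pi] := gphi.
have [al al0 alP] := row_ratio_cvg gphi hpos; pose h n := phi (row_shape n).
pose psi la n := phi (cons_row n la) / h n.
have hn0 n : h n != 0 by rewrite gt_eqF ?hpos.
(* The Pieri rule for strips of size n, divided by h n; the term of nu = la is
   psi la n, and the other terms involve smaller diagrams. *)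
have row n la : (row_len la 0 <= n)%N -> phi la =
   \sum_(nu <- diagrams_upto (level la) | strip true nu la)
     (h (n + (level la - level nu))%N / h n) * psi nu (n + (level la - level nu))%N.
  move=> ln; have := pi true n la; rewrite strip_up_empty_row strip_up_row // => E.
  apply: (mulfI (hn0 n)); rewrite -E mulr_sumr; apply: eq_bigr => nu _.
  rewrite /psi; set m := (n + _)%N; move: (hn0 n) (hn0 m) => hn hm.
  by field; rewrite hn hm.
have term nu (l : R) j : psi nu n @[n --> \oo] --> l ->
    (h (n + j)%N / h n) * psi nu (n + j)%N @[n --> \oo] --> al ^+ j * l.
  move=> c; apply: cvgM; first exact: alP.
  exact: cvgn_shift c.
have cv la : cvgn (psi la).
  elim/ltn_ind: {la}(level la) {-2}la (erefl (level la)) => N IH la lN.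
  apply/cvg_ex; exists (phi la - \sum_(nu <- diagrams_upto (level la) | strip true nu la && (nu
    != la))
     al ^+ (level la - level nu) * limn (psi nu)).
  apply: (@cvgn_eventually_eq _ (fun n =>
    phi la - \sum_(nu <- diagrams_upto (level la) | strip true nu la && (nu != la))
     (h (n + (level la - level nu))%N / h n) * psi nu (n + (level la - level nu))%N) _ _
       (row_len la 0)).
    move=> n ln; rewrite {1}(row n la ln) (@sum_pick_seq _ _ _ (fun nu =>
      strip true nu la) _ la (diagrams_upto_uniq _)) ?mem_diagrams_upto ?strip_refl //.
    by rewrite subnn addn0 divff // mul1r addrK.
  apply: cvgB; first exact: cvg_cst.
  apply: cvgn_sum => nu nl /andP[s ne]; apply: term.
  apply: (IH (level nu)) => //; rewrite -lN ltn_neqAle (strip_level s) andbT.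
  by apply: contra ne => /eqP /(strip_level_eq s) ->.
pose phi' la := limn (psi la).
have c' la : psi la n @[n --> \oo] --> phi' la by exact: cv.
have downE la : phi la = strip_down true al phi' la.
  apply: (@cvgn_unique _ (fun=> phi la)); first exact: cvg_cst.
  apply: (@cvgn_eventually_eq _ _ _ _ (row_len la 0) (fun n nl => esym (row n la nl))).
  by apply: cvgn_sum => nu _ _; exact: term.
have one' : phi' empty_diagram = 1.
  apply: cvgn_unique (c' _) _; apply: (@cvgn_eventually_eq _ (fun=> 1) _ _ 0);
    last exact: cvg_cst.
  by move=> n _; apply/esym/divff/hn0.
have upcv b m a la : strip_up b m (fun mu =>
  phi (cons_row (n + a) mu)) la / h n @[n --> \oo] -->
    al ^+ a * strip_up b m phi' la.
  rewrite mulr_sumr; under eq_fun do rewrite mulr_suml.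
  apply: cvgn_sum => mu _ _.
  apply: (@cvgn_eventually_eq _ (fun n => (h (n + a)%N / h n) * psi mu (n + a)%N) _ _ 0);
    last exact: term.
  by move=> n _; move: (hn0 n) (hn0 (n + a)%N) => hn hm; rewrite /psi; field; rewrite hn hm.
(* The Pieri rule at the diagrams (n, la), divided by h n, in the limit. *)
have upE b m la : \sum_(a < m.+1 | b || (a <= 1)%N) al ^+ a * strip_up b (m - a) phi' la =
    strip_up b m phi empty_diagram * phi' la.
  apply: (@cvgn_unique _ (fun n => strip_up b m phi (cons_row n la) / h n)).
    apply: (@cvgn_eventually_eq _ (fun n => \sum_(a < m.+1 | b || (a <= 1)%N)
       (strip_up b (m - a) (fun mu =>
         phi (cons_row (n + a) mu)) la / h n)) _ _ (row_len la 0 + m)).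
      by move=> n ln; rewrite strip_up_cons_row // mulr_suml.
    by apply: cvgn_sum => a _ _; exact: upcv.
  apply: (@cvgn_eventually_eq _ (fun n => strip_up b m phi empty_diagram * psi la n) _ _ 0).
    by move=> n _; rewrite (pi b m (cons_row n la)) mulrA.
  by apply: cvgM; [exact: cvg_cst|exact: c'].
exists al, phi'; split=> //.
- split=> // [la|b m la].
    by apply: (@cvgn_ge0 _ _ _ 0 _ (c' la)) => n _; rewrite divr_ge0 // ltW // hpos.
  suff [c cE] : exists c, forall la, strip_up b m phi' la = c * phi' la.
    by rewrite !cE one' mulr1.
  (* The term a = 0 of upE is the value wanted, the other ones have smaller m. *)
  elim/ltn_ind: m {la} => m IH.
  have /choice[c cE] : forall a : 'I_m, exists c, forall la,
    strip_up b (m - a.+1) phi' la = c * phi' la.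
    by move=> a; apply: IH; have := ltn_ord a; lia.
  exists (strip_up b m phi empty_diagram -
     \sum_(a < m | b || (a.+1 <= 1)%N) al ^+ a.+1 * c a) => la.
  have E : strip_up b m phi' la + \sum_(a < m | b || (a.+1 <= 1)%N) al ^+ a.+1 * c a * phi' la =
      strip_up b m phi empty_diagram * phi' la.
    rewrite -upE [RHS]big_mkcond big_ord_recl orbT expr0 mul1r subn0; congr (_ + _).
    by rewrite [LHS]big_mkcond; apply: eq_bigr => a _; rewrite -mulrA -cE.
  by rewrite mulrBl -E mulr_suml addrK.
- by apply/funext.
- move=> k l hk la nh; apply: cvgn_unique (c' la) _.
  apply: (@cvgn_eventually_eq _ (fun=> 0) _ _ (row_len la 0)); last exact: cvg_cst.
  move=> n ln; rewrite /psi hk ?mul0r //.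
  by rewrite /in_hook -/(row_len _ _) row_len_cons_row.
Qed.

Lemma strip_down_ge (R : realType) b (x : R) (f : diagram -> R) la :
  0 <= x -> (forall la, 0 <= f la) -> f la <= strip_down b x f la.
Proof.
move=> x0 f0; rewrite /strip_down (@sum_pick_seq _ _ _ (fun nu =>
  strip b nu la) _ la (diagrams_upto_uniq _)) ?mem_diagrams_upto ?strip_refl //.
by rewrite subnn mul1r lerDl sumr_ge0 // => nu _; rewrite mulr_ge0 // exprn_ge0.
Qed.


Lemma strip_down0 (R : pzRingType) b (f : diagram -> R) : strip_down b 0 f = f.
Proof.
apply/funext => la.
rewrite /strip_down (@sum_pick_seq _ _ _ (fun nu =>
  strip b nu la) _ la (diagrams_upto_uniq _)) ?mem_diagrams_upto ?strip_refl //.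
rewrite subnn mul1r big1 ?addr0 // => nu /andP[s ne].
rewrite expr0n subn_eq0; case: leqP => [le|]; last by rewrite mul0r.
move: ne; rewrite (strip_level_eq s) ?eqxx //.
by apply/eqP; rewrite eqn_leq le (strip_level s).
Qed.

(** If phi vanishes at the row with r cells, it vanishes at every diagram with a
    first row of at least r cells, since such a diagram is obtained from its
    lower rows by adding a horizontal strip. *)
Lemma row_vanish (R : realType) (phi : diagram -> R) r mu : positive_pieri phi ->
  phi (row_shape r) = 0 -> (r <= row_len mu 0)%N -> phi mu = 0.
Proof.
move=> [ge0 one pi] hr rm.
have hn n : (r <= n)%N -> phi (row_shape n) = 0.
  move=> rn; rewrite -(subnK rn); elim: (n - r)%N => [//|k IH].
  apply/eqP; rewrite eq_le ge0 andbT.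
  have := @strip_up_ge _ phi true 1 (row_shape (k + r)) (row_shape (k.+1 + r)) ge0.
  rewrite pi IH mulr0; apply; last by rewrite !level_row_shape; lia.
  by apply/asboolP => -[|i]; rewrite !row_len_row_shape.
apply/eqP; rewrite eq_le ge0 andbT.
have := @strip_up_ge _ phi true (row_len mu 0) (behead_row mu) mu ge0.
rewrite pi strip_up_empty_row hn // mul0r; apply.
  by apply/asboolP => i; rewrite row_len_behead_row row_len_anti.
by rewrite addnC -level_behead_row.
Qed.

Lemma level_box la : (level la <= size la * row_len la 0)%N.
Proof.
rewrite (level_row_len (leqnn _)); apply: (@leq_trans (\sum_(i < size la) row_len la 0)%N).
  by apply: leq_sum => i _; exact: row_len_anti.
by rewrite sum_nat_const card_ord.
Qed.

(** When phi vanishes at some row and at some column, its support is finite.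
    The sum of phi over the successors of la is phi(1) * phi(la), so phi(1) is
    zero, and nothing but the empty diagram is left. *)
Lemma positive_pieri_degenerate (R : realType) (phi : diagram -> R) r c : positive_pieri phi ->
  phi (row_shape r) = 0 -> phi (col_shape c) = 0 -> phi = delta R.
Proof.
move=> g hr hc; have [ge0 one pi] := g.
(* A diagram with at least c * r cells does not fit in a box with fewer than c
   rows and r columns. *)
have van la : (c * r <= level la)%N -> phi la = 0.
  move=> le; have [lr|] := leqP r (row_len la 0); first exact: row_vanish hr lr.
  move=> lt; have [lc|ltc] := leqP c (size la).
    rewrite -(conj_diagramK la);
      apply: (@row_vanish _ (phi \o conj_diagram) c) (positive_pieri_conj g) hc _.
    by rewrite -size_conj_diagram conj_diagramK.
  have := level_box la; have : (size la * row_len la 0 < c * r)%N by nia.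
  lia.
have h1 : phi (row_shape 1) = 0.
  (* Otherwise phi vanishes from level N on if it does from level N + 1 on. *)
  apply: contrapT => /eqP h1.
  have : forall N, (forall la, (N <= level la)%N -> phi la = 0) -> phi empty_diagram = 0.
    elim=> [|N IH] hN; first exact: hN.
    apply: IH => la; rewrite leq_eqVlt => /orP[/eqP E|]; last exact: hN.
    have := pi true 1%N la; rewrite strip_up_empty_row /strip_up big_seq_cond big1.
      by move/esym/eqP; rewrite mulf_eq0 (negPf h1) => /eqP.
    by move=> mu; rewrite mem_diagrams -E => /andP[/eqP lm _]; apply: hN; rewrite lm addn1.
  by move/(_ _ van)/eqP; rewrite one oner_eq0.
apply/funext => la; rewrite /delta; case: eqP => [->//|ne].
apply: (row_vanish g h1); rewrite lt0n; apply/eqP => l0; apply: ne.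
by apply: row_len_ext => i; rewrite row_len_empty; apply/eqP; rewrite -leqn0 -l0 row_len_anti.
Qed.

Lemma foldr_down0 (R : pzRingType) b n (f : diagram -> R) :
  foldr (strip_down b) f (nseq n 0) = f.
Proof. by elim: n => //= n ->; rewrite strip_down0. Qed.

(** Peeling of rows only, once the values at one-column diagrams vanish from some
    point on. *)
Lemma peel_rows (R : realType) k l c (phi : diagram -> R) : positive_pieri phi ->
  hook_supported k l phi -> phi (col_shape c) = 0 ->
  exists s : seq R, [/\ size s = k, all (fun x => 0 <= x) s &
    phi = foldr (strip_down true) (delta R) s].
Proof.
elim: k phi => [|k IH] phi g hk hc.
  exists [::]; split=> //=; apply: (@positive_pieri_degenerate _ _ l.+1 c g _ hc).
  by apply: hk; rewrite /in_hook -/(row_len _ _) row_len_row_shape ltnn.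
have [[r hr]|nh] := pselect (exists r, phi (row_shape r) = 0).
  exists (nseq k.+1 0); split; rewrite ?size_nseq ?foldr_down0 //.
    by rewrite all_nseq lexx orbT.
  exact: positive_pieri_degenerate g hr hc.
have pos n : 0 < phi (row_shape n).
  case: g => ge0 _ _; rewrite lt_neqAle ge0 andbT; apply/eqP => E; apply: nh; by exists n.
have [al [phi' [al0 g' E hk']]] := peel_row g pos.
have [|s [sk s0 E']] := IH phi' g' (hk' _ _ hk).
  case: g' => ge0' _ _; apply/eqP; rewrite eq_le ge0' andbT -hc E.
  exact: strip_down_ge.
by exists (al :: s); rewrite /= sk al0 s0 -E'.
Qed.

(** Columns are peeled first, so that the vertical strips are the outermost ones,
    as the order of the alphabet requires. Missing parameters are zeros. *)
Lemma peel_all (R : realType) k l (phi : diagram -> R) : positive_pieri phi ->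
  hook_supported k l phi ->
  exists s t : seq R, [/\ size s = l /\ size t = k, all (fun x => 0 <= x) s,
    all (fun x => 0 <= x) t &
    phi = foldr (strip_down false) (foldr (strip_down true) (delta R) t) s].
Proof.
elim: l phi => [|l IH] phi g hk.
  have hc : phi (col_shape k.+1) = 0.
    by apply: hk; rewrite in_hook_conj /in_hook -/(row_len _ _) row_len_row_shape ltnn.
  by have [t [tk t0 E]] := peel_rows g hk hc; exists [::], t.
have [[c hc]|nh] := pselect (exists c, phi (col_shape c) = 0).
  have [t [tk t0 E]] := peel_rows g hk hc; exists (nseq l.+1 0), t.
  split; rewrite ?size_nseq ?foldr_down0 //.
  by rewrite all_nseq lexx orbT.
have pos n : 0 < (phi \o conj_diagram) (row_shape n).
  case: g => ge0 _ _; rewrite lt_neqAle ge0 andbT; apply/eqP => E; apply: nh; by exists n.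
have [al [phi' [al0 g' E hk']]] := peel_row (positive_pieri_conj g) pos.
have [|s [t [[sl tk] s0 t0 E']]] := IH (phi' \o conj_diagram) (positive_pieri_conj g').
  by apply: hook_supported_conj; apply: hk'; exact: hook_supported_conj.
exists (al :: s), t; rewrite /= sl al0 s0 -E'; split=> //.
apply/funext => la; rewrite strip_down_conj -E /=; by rewrite conj_diagramK.
Qed.

(** * Hook Schur functions as sums over chains of strips *)

Lemma cell_lt la (c : cell la) : (col_of c < row_len la (row_of c))%N.
Proof. by case: c => i j; exact: ltn_ord. Qed.

Lemma mkcell_subproof la i j : (j < row_len la i)%N -> (i < size la)%N.
Proof. by rewrite -row_len_gt0; exact: leq_ltn_trans. Qed.

(** The cell of la in row i and column j. *)
Definition mkcell la i j (h : (j < row_len la i)%N) : cell la :=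
  existT (fun i : 'I_(size la) => 'I_(nth 0%N la i))
    (Ordinal (mkcell_subproof h)) (Ordinal h).

Lemma cell_eq la (c d : cell la) : row_of c = row_of d -> col_of c = col_of d -> c = d.
Proof.
case: c d => [[i hi] [j hj]] [[i' hi'] [j' hj']]; rewrite /row_of /col_of /= => ei ej.
subst i' j'; rewrite (bool_irrelevance hi' hi) in hj' *.
by rewrite (bool_irrelevance hj' hj).
Qed.

Lemma card_cell la : #|cell la| = level la.
Proof.
rewrite card_tagged sumnE big_map big_enum /= (level_row_len (leqnn _)).
by apply: eq_bigr => i _; rewrite card_ord.
Qed.

(** Semistandard fillings by symbols 0 < 1 < ... < n - 1; a symbol v with [ty v]
    occurs at most once in every column, and the other ones at most once in every
    row. *)
Definition tableau n (ty : nat -> bool) la (S : {ffun cell la -> 'I_n}) : bool :=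
  [forall c, forall d,
    [&& (row_of c == row_of d) && (col_of c <= col_of d)%N ==> (S c <= S d)%N,
        (col_of c == col_of d) && (row_of c <= row_of d)%N ==> (S c <= S d)%N,
        [&& ty (S c), col_of c == col_of d & S c == S d] ==> (c == d) &
        [&& ~~ ty (S c), row_of c == row_of d & S c == S d] ==> (c == d)]].

Lemma tableauP n (ty : nat -> bool) la (S : {ffun cell la -> 'I_n}) :
  reflect [/\ forall c d, row_of c = row_of d -> (col_of c <= col_of d)%N -> (S c <= S d)%N,
      forall c d, col_of c = col_of d -> (row_of c <= row_of d)%N -> (S c <= S d)%N,
      forall c d, ty (S c) -> col_of c = col_of d -> S c = S d -> c = d &
      forall c d, ~~ ty (S c) -> row_of c = row_of d -> S c = S d -> c = d]
    (tableau ty S).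
Proof.
apply: (iffP forallP) => [h|[h1 h2 h3 h4] c].
  split=> c d; have /forallP/(_ d)/and4P[q1 q2 q3 q4] := h c.
  - by move=> /eqP e l; move: q1; rewrite e l.
  - by move=> /eqP e l; move: q2; rewrite e l.
  - by move=> t /eqP e /eqP e'; move: q3; rewrite t e e' => /eqP.
  - by move=> t /eqP e /eqP e'; move: q4; rewrite t e e' => /eqP.
apply/forallP => d; apply/and4P; split; apply/implyP.
- by move=> /andP[/eqP e l]; exact: h1.
- by move=> /andP[/eqP e l]; exact: h2.
- by move=> /and3P[t /eqP e /eqP e']; apply/eqP; exact: h3.
- by move=> /and3P[t /eqP e /eqP e']; apply/eqP; exact: h4.
Qed.

(** The generating function of these fillings, with weight w v for symbol v. *)
Definition ordinal_schur (R : comNzRingType) n (ty : nat -> bool) (w : nat -> R) la : R :=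
  \sum_(S : {ffun cell la -> 'I_n} | tableau ty S) \prod_(c : cell la) w (S c).

(** The cells with a symbol less than the maximal symbol n form the diagram nu. *)
Definition below_max n la nu (S : {ffun cell la -> 'I_n.+1}) : bool :=
  [forall c, (S c < n)%N == (col_of c < row_len nu (row_of c))%N].

Lemma below_max_ex n ty la (S : {ffun cell la -> 'I_n.+1}) : tableau ty S ->
  exists2 nu, strip (ty n) nu la & below_max nu S.
Proof.
move=> /tableauP[h1 h2 h3 h4].
pose P i j := [exists c, [&& row_of c == i, col_of c == j & (S c < n)%N]].
have PE c : (S c < n)%N = P (row_of c) (col_of c).
  apply/idP/existsP => [h|[d /and3P[/eqP e1 /eqP e2]]]; first by exists c; rewrite !eqxx.
  by rewrite (cell_eq e1 e2).
have nuE : forall i j, (j < row_len (downset P (size la) (row_len la 0)) i)%N = P i j.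
  apply: downsetE => i j /existsP[c /and3P[/eqP ei /eqP ej Sc]].
  - have h : (j < row_len la i)%N.
      by rewrite -ej (leq_trans (cell_lt c)) // row_len_anti // ei.
    rewrite -[i]/(row_of (mkcell h)) -[j]/(col_of (mkcell h)) -PE.
    by apply: leq_ltn_trans Sc; apply: h2; rewrite ?ei.
  - have h : (j < row_len la i)%N.
      by rewrite -ei (leq_trans _ (cell_lt c)) // ej ltnS leqnSn.
    rewrite -[i]/(row_of (mkcell h)) -[j]/(col_of (mkcell h)) -PE.
    by apply: leq_ltn_trans Sc; apply: h1; rewrite ?ej.
  - have := cell_lt c; rewrite ei ej => h.
    by rewrite (mkcell_subproof h) (leq_trans h) // row_len_anti.
exists (downset P (size la) (row_len la 0)); last first.
  by apply/forallP => c; rewrite nuE PE.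
apply/asboolP => i; split.
  apply/leq_ltnP => j; rewrite nuE => /existsP[c /and3P[/eqP <- /eqP <- _]].
  exact: cell_lt.
have max (c d : cell la) : (S c <= S d)%N -> ~~ (S c < n)%N -> S c = S d /\ S c = n :> nat.
  move=> le; rewrite -leqNgt => ge; split; last first.
    by apply/eqP; rewrite eqn_leq ge -ltnS ltn_ord.
  by apply/val_inj/eqP; rewrite eqn_leq le /= (leq_trans _ ge) // -ltnS ltn_ord.
case: ifP => tyn; apply/leq_ltnP => j.
  move=> hd; have hc : (j < row_len la i)%N by rewrite (leq_trans hd) ?row_len_anti.
  rewrite nuE -[i]/(row_of (mkcell hc)) -[j]/(col_of (mkcell hc)) -PE.
  apply: contraT => nc;
    have [e en] := max _ (mkcell hd) (h2 (mkcell hc) (mkcell hd) erefl (leqnSn i)) nc.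
  have := h3 (mkcell hc) (mkcell hd) _ erefl e;
    rewrite en => /(_ tyn) /(congr1 (@row_of la)) /=.
  by rewrite /row_of /=; lia.
case: j => // j hd; have hc : (j < row_len la i)%N by rewrite (leq_trans _ hd).
rewrite ltnS nuE -[i]/(row_of (mkcell hc)) -[j]/(col_of (mkcell hc)) -PE.
apply: contraT => nc;
  have [e en] := max _ (mkcell hd) (h1 (mkcell hc) (mkcell hd) erefl (leqnSn j)) nc.
have := h4 (mkcell hc) (mkcell hd) _ erefl e;
  rewrite en tyn => /(_ isT) /(congr1 (@col_of la)) /=.
by rewrite /col_of /=; lia.
Qed.

Lemma below_max_uniq n la nu nu' (S : {ffun cell la -> 'I_n.+1}) :
  sub_diagram nu la -> sub_diagram nu' la -> below_max nu S -> below_max nu' S -> nu = nu'.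
Proof.
move=> /asboolP s /asboolP s' /forallP m /forallP m'; apply: cells_ext => i j.
have [h|nh] := boolP (j < row_len la i)%N.
  by have /eqP := m (mkcell h); have /eqP := m' (mkcell h) => -> .
by apply/idP/idP => h; case/negP: nh; rewrite (leq_trans h).
Qed.

(** The filling of la that agrees with S on nu and has the maximal symbol n on the
    other cells. *)
Definition extend n la nu (S : {ffun cell nu -> 'I_n}) : {ffun cell la -> 'I_n.+1} :=
  [ffun c => if [pick d | (row_of d == row_of c) && (col_of d == col_of c)] is Some d
             then widen_ord (leqnSn n) (S d) else ord_max].

Lemma extend_in n la nu (S : {ffun cell nu -> 'I_n}) (c : cell la) (d : cell nu) :
  row_of d = row_of c -> col_of d = col_of c -> extend la S c = S d :> nat.
Proof.
move=> er ec; rewrite ffunE; case: pickP => [d' /andP[/eqP er' /eqP ec']|/(_ d)].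
  by rewrite (@cell_eq _ d' d) ?er' ?ec'.
by rewrite er ec !eqxx.
Qed.

Lemma extend_out n la nu (S : {ffun cell nu -> 'I_n}) (c : cell la) :
  ~~ (col_of c < row_len nu (row_of c))%N -> extend la S c = n :> nat.
Proof.
move=> nc; rewrite ffunE; case: pickP => [d /andP[/eqP er /eqP ec]|//].
by case/negP: nc; rewrite -er -ec cell_lt.
Qed.

Lemma extend_lt n la nu (S : {ffun cell nu -> 'I_n}) (c : cell la) :
  (extend la S c < n)%N = (col_of c < row_len nu (row_of c))%N.
Proof.
have [h|nh] := boolP (col_of c < row_len nu (row_of c))%N; last by rewrite extend_out // ltnn.
by rewrite (@extend_in _ _ _ _ _ (mkcell h)) // ltn_ord.
Qed.

Lemma extend_tableau n ty la nu (S : {ffun cell nu -> 'I_n}) : strip (ty n) nu la ->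
  tableau ty S -> tableau ty (extend la S).
Proof.
move=> /asboolP st /tableauP[h1 h2 h3 h4].
have le_max (c : cell la) : (extend la S c <= n)%N by rewrite -ltnS ltn_ord.
have mono (c d : cell la) : ((col_of d < row_len nu (row_of d)) ->
  (col_of c < row_len nu (row_of c)))%N ->
    (forall c' d' : cell nu, row_of c' = row_of c -> col_of c' = col_of c ->
      row_of d' = row_of d -> col_of d' = col_of d -> (S c' <= S d')%N) ->
    (extend la S c <= extend la S d)%N.
  move=> i h; have [hd|nd] := boolP (col_of d < row_len nu (row_of d))%N; last first.
    by rewrite (extend_out _ nd).
  rewrite (@extend_in _ _ _ _ c (mkcell (i hd))) // (@extend_in _ _ _ _ d (mkcell hd)) //.
  exact: h.
have inj (c d : cell la) : extend la S c = extend la S d ->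
    (forall c' d' : cell nu, row_of c' = row_of c -> col_of c' = col_of c ->
      row_of d' = row_of d -> col_of d' = col_of d -> S c' = S d' ->
      extend la S c = S c' :> nat -> c' = d') ->
    (extend la S c = n :> nat -> ~~ (col_of c < row_len nu (row_of c))%N ->
      ~~ (col_of d < row_len nu (row_of d))%N -> c = d) -> c = d.
  move=> e hin hout; have ein := extend_lt S c; rewrite e extend_lt in ein.
  have [hc|nc] := boolP (col_of c < row_len nu (row_of c))%N.
    have hd : (col_of d < row_len nu (row_of d))%N by rewrite ein.
    have ec : extend la S c = S (mkcell hc) :> nat by exact: extend_in.
    have ed : extend la S d = S (mkcell hd) :> nat by exact: extend_in.
    have E : S (mkcell hc) = S (mkcell hd) by apply: val_inj; rewrite /= -ec -ed e.
    have := hin (mkcell hc) (mkcell hd) erefl erefl erefl erefl E ec.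
    by move=> E'; apply: cell_eq;
      [exact: (congr1 (@row_of nu) E')|exact: (congr1 (@col_of nu) E')].
  by apply: hout; rewrite ?extend_out ?ein.
apply/tableauP; split=> c d.
- move=> er lc; apply: mono => [|c' d' r1 k1 r2 k2].
    by rewrite er; exact: leq_ltn_trans.
  by apply: h1; rewrite ?r1 ?r2 ?k1 ?k2.
- move=> ec lr; apply: mono => [h|c' d' r1 k1 r2 k2].
    by rewrite ec (leq_trans h) // row_len_anti.
  by apply: h2; rewrite ?r1 ?r2 ?k1 ?k2.
- move=> t ec e; apply: (inj c d e) => [c' d' r1 k1 r2 k2 E en|en nc nd].
    by apply: h3; rewrite -?en ?k1 ?k2.
  rewrite en in t; rewrite t in st.
  have := cell_lt c; have := cell_lt d; rewrite ec in nc *.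
  case: (ltngtP (row_of c) (row_of d)) => [lt|lt|eq] hd hc; last exact: cell_eq.
    case/negP: nc; apply: leq_trans hd _; apply: leq_trans (row_len_anti _ lt) _.
    by case: (st (row_of c)).
  case/negP: nd; apply: leq_trans hc _; apply: leq_trans (row_len_anti _ lt) _.
  by case: (st (row_of d)).
- move=> t er e; apply: (inj c d e) => [c' d' r1 k1 r2 k2 E en|en nc nd].
    by apply: h4; rewrite -?en ?r1 ?r2.
  rewrite en in t; rewrite (negPf t) in st.
  have := cell_lt c; have := cell_lt d; have [_] := st (row_of d).
  rewrite er in nc *; move: nc nd; rewrite -!leqNgt => nc nd le hd hc.
  by apply: cell_eq => //; apply/eqP; rewrite eqn_leq; apply/andP; split; lia.
Qed.

Lemma tableau_restrict n ty la nu (S : {ffun cell la -> 'I_n.+1}) :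
  sub_diagram nu la -> tableau ty S -> below_max nu S ->
  exists2 S' : {ffun cell nu -> 'I_n}, tableau ty S' & extend la S' = S.
Proof.
move=> /asboolP sub /tableauP[h1 h2 h3 h4] /forallP bm.
have hin (d : cell nu) : (col_of d < row_len la (row_of d))%N by rewrite (leq_trans (cell_lt
  d)).
have hS (d : cell nu) : (S (mkcell (hin d)) < n)%N.
  by have /eqP -> := bm (mkcell (hin d)); exact: cell_lt.
exists [ffun d => Ordinal (hS d)].
  apply/tableauP; split=> c d; rewrite !ffunE /=.
  - by move=> e l; exact: h1.
  - by move=> e l; exact: h2.
  - move=> t e /(congr1 val) /= E.
    have := h3 (mkcell (hin c)) (mkcell (hin d)) t e (val_inj E) => F.
    by apply: cell_eq => //; exact: (congr1 (@row_of la) F).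
  - move=> t e /(congr1 val) /= E.
    have := h4 (mkcell (hin c)) (mkcell (hin d)) t e (val_inj E) => F.
    by apply: cell_eq => //; exact: (congr1 (@col_of la) F).
apply/ffunP => c; apply: val_inj => /=.
have [h|nh] := boolP (col_of c < row_len nu (row_of c))%N.
  rewrite (@extend_in _ _ _ _ c (mkcell h)) // ffunE /=.
  by congr (nat_of_ord (S _)); exact: cell_eq.
rewrite extend_out //; have /eqP := bm c; rewrite (negPf nh) => /negbT; rewrite -leqNgt => ge.
by apply/eqP; rewrite eqn_leq ge -ltnS ltn_ord.
Qed.

Lemma extend_inj n la nu : sub_diagram nu la ->
  injective (@extend n la nu).
Proof.
move=> /asboolP sub S S' E; apply/ffunP => d; apply: val_inj => /=.
have h : (col_of d < row_len la (row_of d))%N by rewrite (leq_trans (cell_lt d)).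
by rewrite -!(@extend_in n la nu _ (mkcell h) d) // E.
Qed.

Lemma extend_weight (R : comNzRingType) n (w : nat -> R) la nu (S : {ffun cell nu -> 'I_n}) :
  sub_diagram nu la -> \prod_(c : cell la) w (extend la S c) =
  w n ^+ (level la - level nu) * \prod_(d : cell nu) w (S d).
Proof.
move=> /asboolP sub.
have hin (d : cell nu) : (col_of d < row_len la (row_of d))%N by rewrite (leq_trans (cell_lt
  d)).
pose f (d : cell nu) := mkcell (hin d).
have finj : injective f.
  by move=> d d' E; apply: cell_eq;
    [exact: (congr1 (@row_of la) E)|exact: (congr1 (@col_of la) E)].
pose A := [set f d | d : cell nu]%SET.
have AE c : (c \in A) = (col_of c < row_len nu (row_of c))%N.
  apply/imsetP/idP => [[d _ ->]|h]; first exact: cell_lt.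
  by exists (mkcell h) => //; exact: cell_eq.
rewrite (bigID [in A]) /= mulrC; congr (_ * _); last first.
  rewrite big_imset /=; last by move=> ? ? _ _; exact: finj.
  by apply: eq_bigr => d _; rewrite (@extend_in _ _ _ _ (f d) d).
rewrite (eq_bigr (fun=> w n)) => [|c]; last by rewrite AE => /(extend_out S) ->.
rewrite prodr_const; congr (_ ^+ _).
rewrite -(card_cell la) -(card_cell nu) -(card_imset predT finj) -/A -(cardC (mem A)).
by rewrite addKn.
Qed.

(** Branching rule: the cells with the maximal symbol form a strip. *)
Lemma ordinal_schurS (R : comNzRingType) n ty (w : nat -> R) la :
  ordinal_schur n.+1 ty w la = strip_down (ty n) (w n) (ordinal_schur n ty w) la.
Proof.
pose W (S : {ffun cell la -> 'I_n.+1}) := \prod_(c : cell la) w (S c).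
transitivity (\sum_(nu <- diagrams_upto (level la) | strip (ty n) nu la)
   \sum_(S : {ffun cell la -> 'I_n.+1} | tableau ty S && below_max nu S) W S).
  rewrite (exchange_big_dep (fun S => tableau ty S)) /=; last by move=> nu S _ /andP[].
  apply: eq_bigr => S t; have [nu s m] := below_max_ex t.
  rewrite (@sum_pick_seq _ _ _ _ _ nu (diagrams_upto_uniq _)) ?mem_diagrams_upto ?(strip_level
    s) ?s ?t ?m //.
  rewrite [X in _ = _ + X]big1 ?addr0 // => nu' /andP[/and3P[s' _ m']] /negP[]; apply/eqP.
  exact: below_max_uniq (strip_sub s') (strip_sub s) m' m.
apply: eq_bigr => nu s; have sub := strip_sub s.
rewrite /ordinal_schur mulr_sumr.
rewrite (eq_bigl [in (@extend n la nu) @: [set S' | tableau ty S']%SET]) => [|S].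
  rewrite big_imset /=; last by move=> ? ? _ _; exact: extend_inj.
  under eq_bigl do rewrite inE.
  by apply: eq_bigr => S _; rewrite /W extend_weight.
apply/andP/imsetP => [[t m]|[S' + ->]].
  by have [S' t' E] := tableau_restrict sub t m; exists S'; rewrite ?inE.
rewrite inE => t'; split; first exact: extend_tableau.
by apply/forallP => c; rewrite extend_lt.
Qed.

Lemma ordinal_schur0 (R : comNzRingType) ty (w : nat ->
  R) la : ordinal_schur 0 ty w la = delta R la.
Proof.
rewrite /ordinal_schur /delta; case: eqP => [->|ne].
  have C0 : #|cell empty_diagram| = 0%N by rewrite card_cell.
  have noc (c : cell empty_diagram) : False by have := card0_eq C0 c; rewrite inE.
  pose S0 : {ffun cell empty_diagram -> 'I_0} := [ffun c => match noc c with end].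
  rewrite (bigD1 S0) /=; last by apply/tableauP; split=> c; case: (noc c).
  rewrite big1 => [|c]; last by case: (noc c).
  rewrite big1 ?addr0 // => S /andP[_ /eqP[]]; apply/ffunP => c; by case: (noc c).
rewrite big1 // => S _; have [c _|n0] := pickP (fun c : cell la => true).
  by case: (S c).
by case: ne; apply: level_eq0; rewrite -card_cell; apply: eq_card0.
Qed.

(** The order of the variables of the same kind is immaterial. *)
Lemma foldr_down_perm (R : comNzRingType) b (f : diagram -> R) (s s' : seq R) :
  perm_eq s s' -> foldr (strip_down b) f s = foldr (strip_down b) f s'.
Proof.
(* One variable can be moved to the front. *)
have swap x s1 s2 : foldr (strip_down b) f (s1 ++ x :: s2) = strip_down b x (foldr (strip_down
  b) f (s1 ++ s2)).
  elim: s1 => //= y s1 ->; apply/funext => la; exact: strip_down_comm.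
elim: s s' => [|x s IH] s' /=; first by move=> /perm_size/esym/size0nil ->.
move=> p; have xs : x \in s' by rewrite -(perm_mem p) mem_head.
case: (path.splitPr xs) p => s1 s2 p; rewrite swap (IH (s1 ++ s2)) //.
move: p; rewrite -cat1s -(cat1s x s2) perm_sym perm_catCA /= perm_cons perm_sym; exact.
Qed.

Lemma ordinal_schur_foldr (R : comNzRingType) (as_ bs : seq R) k l la
    (w := fun v => if (v < k)%N then nth 0 as_ v else nth 0 bs (k + l - v.+1)) :
  size as_ = k -> size bs = l ->
  ordinal_schur (k + l) (fun v => v < k)%N w la =
  foldr (strip_down false) (foldr (strip_down true) (delta R) (rev as_)) bs la.
Proof.
move=> sk sl; set ty := fun v => _.
have Hk n : (n <= k)%N ->
  ordinal_schur n ty w = foldr (strip_down true) (delta R) (rev (take n as_)).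
  elim: n => [_|n IH nk]; first by apply/funext => mu; rewrite take0 ordinal_schur0.
  rewrite (take_nth 0) ?sk // rev_rcons /=; apply/funext => mu.
  by rewrite ordinal_schurS /ty /w nk IH // ltnW.
have Hl m : (m <= l)%N -> ordinal_schur (k + m) ty w =
    foldr (strip_down false) (foldr (strip_down true) (delta R) (rev as_)) (drop (l - m) bs).
  elim: m => [_|m IH ml].
    by rewrite addn0 subn0 drop_oversize ?sl // Hk // take_oversize ?sk.
  rewrite (drop_nth 0) ?sl; last by lia.
  rewrite /= (_ : (l - m.+1).+1 = l - m)%N; last by lia.
  rewrite -IH; last exact: ltnW.
  apply/funext => mu; rewrite addnS ordinal_schurS /ty /w ltnNge leq_addr /=.
  by rewrite (_ : (k + l - (k + m).+1 = l - m.+1)%N) //; lia.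
by rewrite Hl // subnn drop0.
Qed.

(** The alphabet of the hook Schur function in increasing order: the symbol i is
    numbered i - 1, and the symbol j^* is numbered k + l - j. *)
Lemma hook_schur_ordinal_schur (R : realType) k l la (alpha : 'I_k -> R) (beta : 'I_l -> R)
   (w : nat -> R) :
  (forall i, w (nat_of_ord i) = alpha i) -> (forall j : 'I_l, w (k + l - j.+1)%N = beta j) ->
  hook_schur la alpha beta = ordinal_schur (k + l) (fun v => v < k)%N w la.
Proof.
move=> wa wb.
have multE (S : filling k l la) a : mult S a = #|[pred c | S c == a]|.
  by apply: eq_card => c; apply/idP/idP => [/set_mem|h]; [|exact: mem_set].
pose enc (a : symbol k l) : 'I_(k + l) :=
  match a with inl i => lshift l i | inr j => rshift k (rev_ord j) end.
pose dec (x : 'I_(k + l)) : symbol k l :=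
  match fintype.split x with inl i => inl i | inr j => inr (rev_ord j) end.
have encK : cancel enc dec.
  move=> [i|j]; rewrite /dec /enc.
    by rewrite -[lshift l i]/(unsplit (inl i)) unsplitK.
  by rewrite -[rshift _ _]/(unsplit (inr (rev_ord j))) unsplitK rev_ordK.
have decK : cancel dec enc.
  move=> x; rewrite /dec; rewrite -[RHS]splitK; case: (fintype.split x) => [i|j] //=.
  by rewrite rev_ordK.
have encw a : w (enc a) = match a with inl i => alpha i | inr j => beta j end.
  case: a => [i|j] /=; first exact: wa.
  by rewrite -wb; congr w; have := ltn_ord j; lia.
have enc_le a b : symbol_le a b = (enc a <= enc b)%N.
  case: a b => [i|j] [i'|j'] //=; rewrite ?leq_add2l.
  - by apply/esym; have := ltn_ord i; lia.
  - by apply/esym; have := ltn_ord i'; lia.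
  - by have := ltn_ord j; have := ltn_ord j'; lia.
pose h (S : {ffun cell la -> 'I_(k + l)}) : filling k l la := [ffun c => dec (S c)].
pose g (S : filling k l la) : {ffun cell la -> 'I_(k + l)} := [ffun c => enc (S c)].
have hK : cancel h g by move=> S; apply/ffunP => c; rewrite !ffunE decK.
have gK : cancel g h by move=> S; apply/ffunP => c; rewrite !ffunE encK.
rewrite /hook_schur (reindex h); last by exists g => ? _.
apply: eq_big => [S|S _].
  have -> : S = g (h S) by rewrite hK.
  move: (h S) => {}S; rewrite gK /semistandard.
  apply/and4P/tableauP => [[h1 h2 h3 h4]|[h1 h2 h3 h4]].
    split=> c d; rewrite !ffunE.
    - move=> /eqP er lc; rewrite -enc_le.
      by move/forallP/(_ c)/forallP/(_ d)/implyP: h1; apply; rewrite er.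
    - move=> /eqP er lc; rewrite -enc_le.
      by move/forallP/(_ c)/forallP/(_ d)/implyP: h2; apply; rewrite er.
    - case E : (S c) => [i|j] /=; last by rewrite ltnNge leq_addr.
      move=> _ /eqP ec; rewrite -[lshift l i]/(enc (inl i)) => /(can_inj encK) /esym/eqP E'.
      move/forallP/(_ i)/forallP/(_ c)/forallP/(_ d)/implyP: h3 => h3; apply/eqP/h3.
      by rewrite ec E E' eqxx.
    - case E : (S c) => [i|j] /=; first by rewrite ltn_ord.
      move=> _ /eqP ec; rewrite -[rshift _ _]/(enc (inr j)) => /(can_inj encK) /esym/eqP E'.
      move/forallP/(_ j)/forallP/(_ c)/forallP/(_ d)/implyP: h4 => h4; apply/eqP/h4.
      by rewrite ec E E' eqxx.
  split.
  - apply/forallP => c; apply/forallP => d; apply/implyP => /andP[/eqP er lc].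
    by rewrite enc_le; have := h1 c d er lc; rewrite !ffunE.
  - apply/forallP => c; apply/forallP => d; apply/implyP => /andP[/eqP er lc].
    by rewrite enc_le; have := h2 c d er lc; rewrite !ffunE.
  - apply/forallP => i; apply/forallP => c; apply/forallP => d;
    apply/implyP => /and3P[/eqP ec /eqP E /eqP E'].
    by apply/eqP; apply: h3; rewrite ?ffunE ?E ?E' //=.
  - apply/forallP => i; apply/forallP => c; apply/forallP => d;
    apply/implyP => /and3P[/eqP ec /eqP E /eqP E'].
    by apply/eqP; apply: h4; rewrite ?ffunE ?E ?E' //= -leqNgt leq_addr.
have -> : S = g (h S) by rewrite hK.
move: (h S) => {}S; rewrite gK.
under [RHS]eq_bigr do rewrite ffunE encw.
rewrite (partition_big S predT) //= big_sumType /=; congr (_ * _).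
  apply: eq_bigr => i _; rewrite (eq_bigr (fun=> alpha i)) => [|c /eqP -> //].
  by rewrite prodr_const -multE.
apply: eq_bigr => i _; rewrite (eq_bigr (fun=> beta i)) => [|c /eqP -> //].
by rewrite prodr_const -multE.
Qed.

(** * Finite paths and block statistics *)

(** The successors of nu in the Young graph. *)
Definition succs nu := [seq mu <- diagrams (level nu + 1) | strip true nu mu].

Lemma mem_succs nu mu : (mu \in succs nu) = young_edge nu mu.
Proof. by rewrite mem_filter mem_diagrams young_edgeE addn1. Qed.

(** The paths with n steps that start at nu, given by their vertices after nu. *)
Fixpoint paths_from n nu : seq (seq diagram) :=
  if n is n'.+1 then flatten [seq [seq mu :: q | q <- paths_from n' mu] | mu <- succs nu]
  else [:: [::]].

Lemma mem_paths_from n nu q : (q \in paths_from n nu) = (size q == n) && path young_edge nu q.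
Proof.
elim: n nu q => [|n IH] nu q; first by rewrite inE size_eq0; case: q.
apply/flatten_mapP/andP => [[mu + /mapP[q' + ->]]|[]].
  by rewrite mem_succs IH /= => -> /andP[/eqP -> ->].
case: q => // mu q; rewrite /= eqSS => sq /andP[e p].
exists mu; rewrite ?mem_succs //; apply/mapP; exists q => //.
by rewrite IH sq.
Qed.

Lemma paths_from_uniq n nu : uniq (paths_from n nu).
Proof.
elim: n nu => // n IH nu /=; apply: allpairs_uniq_dep => //=.
  by rewrite filter_uniq ?diagrams_uniq.
by move=> [m1 q1] [m2 q2] _ _ /= [-> ->].
Qed.

Lemma level_paths_from n nu q : q \in paths_from n nu -> level (last nu q) = (level nu + n)%N.
Proof.
rewrite mem_paths_from => /andP[/eqP <-]; elim: q nu => [|mu q IH] nu /=;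
  first by rewrite addn0.
by rewrite young_edgeE => /andP[/andP[_ /eqP l] /IH ->]; rewrite l addSnnS.
Qed.

Lemma sum_paths_fromS (R : nmodType) n nu (F : seq diagram -> R) :
  \sum_(q <- paths_from n.+1 nu) F q = \sum_(mu <- succs nu) \sum_(q <- paths_from n mu) F (mu
    :: q).
Proof.
rewrite /= big_flatten big_map; apply: eq_bigr => mu _; by rewrite big_map.
Qed.

Lemma sum_paths_from_cat (R : nmodType) a n nu (F : seq diagram -> R) :
  \sum_(q <- paths_from (a + n) nu) F q =
  \sum_(p <- paths_from a nu) \sum_(q <- paths_from n (last nu p)) F (p ++ q).
Proof.
elim: a nu F => [|a IH] nu F; first by rewrite big_cons big_nil addr0.
rewrite addSn !sum_paths_fromS; apply: eq_bigr => mu _.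
by rewrite IH.
Qed.

(** Any two nested diagrams are joined by a path: add a cell to the first row of
    nu that is shorter than the row of mu. *)
Lemma path_ex nu mu : sub_diagram nu mu ->
  exists2 q, path young_edge nu q & last nu q = mu.
Proof.
move: {2}(level mu - level nu)%N (erefl (level mu - level nu)%N) => n.
elim: n nu => [|n IH] nu ln sub.
  by have le := level_sub sub; exists [::] => //=; apply: (sub_level_eq sub); lia.
have ex : exists i, (row_len nu i < row_len mu i)%N.
  apply: contrapT => /forallNP h.
  have : sub_diagram mu nu by apply/asboolP => i; rewrite leqNgt; apply/negP.
  by move=> /level_sub; lia.
(* The row above the first shorter row i is as long as in mu, so that adding a
   cell to row i gives a diagram. *)
case: (ex_minnP ex) => i lti imin; move/asboolP: (sub) => s.
pose f j := ((i == j) + row_len nu j)%N.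
have fS j : (f j.+1 <= f j)%N.
  rewrite /f; have := row_len_anti nu (leqnSn j).
  case: (i =P j.+1) => [E|_]; case: (i =P j) => [E'|_]; try lia.
  move=> _; rewrite -E add1n (leq_trans lti) //.
  have : ~~ (row_len nu j < row_len mu j)%N by apply/negP => /imin; rewrite E ltnn.
  by rewrite -leqNgt => /(leq_trans _); apply; rewrite E row_len_anti.
pose d := maxn i.+1 (size nu).
have id : (i < d)%N by rewrite leq_maxl.
have fd : f d = 0%N.
  by rewrite /f row_len_ge ?leq_maxr //; case: eqP => // E; rewrite -E ltnn in id.
pose nu' := diagram_of f d; have nu'E : row_len nu' =1 f by exact: row_len_diagram_of.
have l' : level nu' = (level nu).+1.
  rewrite (@level_row_len nu' d); last by apply/leq_ltnP => j; rewrite -row_len_gt0 nu'E /f;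
    case: (ltnP j d) => // h; rewrite row_len_ge ?(leq_trans (leq_maxr _ _) h) // addn0;
    case: eqP => // E; rewrite -E in h; lia.
  rewrite (eq_bigr (fun j : 'I_d => (i == j) + row_len nu j)%N) => [|j _]; last exact: nu'E.
  rewrite big_split /= -(level_row_len (leq_maxr _ _)) (bigD1 (Ordinal id)) //= eqxx.
  rewrite big1 => [|j /negPf ji]; last by rewrite eq_sym -val_eqE /= in ji; rewrite ji.
  by rewrite addn0 add1n.
have e : young_edge nu nu'.
  rewrite young_edgeE l' eqxx andbT; apply/asboolP => j; rewrite !nu'E /f leq_addl; split=> //.
  case: (i =P j.+1) => [E|_]; last exact: row_len_anti.
  rewrite -E add1n (leq_trans lti) //.
  have : ~~ (row_len nu j < row_len mu j)%N by apply/negP => /imin; rewrite E ltnn.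
  by rewrite -leqNgt => /(leq_trans _); apply; rewrite E row_len_anti.
have [||q pq lq] := IH nu'; first by rewrite l'; lia.
  by apply/asboolP => j; rewrite nu'E /f; case: eqP => [<-//|_]; exact: s.
by exists (nu' :: q); rewrite //= e.
Qed.

(** The number of paths with n steps from nu to mu. *)
Definition path_count n nu mu := count (fun q => last nu q == mu) (paths_from n nu).

Lemma path_count_gt0 b n nu mu : strip b nu mu -> level mu = (level nu + n)%N ->
  (0 < path_count n nu mu)%N.
Proof.
move=> /strip_sub/path_ex[q p lq] l; rewrite -has_count; apply/hasP; exists q; last exact/eqP.
rewrite mem_paths_from p andbT; apply/eqP.
have := @level_paths_from (size q) nu q;
  by rewrite mem_paths_from eqxx p lq l => /(_ isT)/addnI.
Qed.

Lemma strip_up_one (R : nmodType) (phi : diagram ->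
  R) : strip_up true 1 phi = strip_up false 1 phi.
Proof.
have H nu mu : level mu = (level nu + 1)%N -> strip true nu mu -> strip false nu mu.
  move=> l s; have sub := strip_sub s; move/asboolP: s => s; apply/asboolP => i.
  by have := sub_row_len_level i sub; case: (s i); lia.
apply/funext => la; rewrite /strip_up big_seq_cond [RHS]big_seq_cond; apply: eq_bigl => mu.
rewrite mem_diagrams; apply: andb_id2l => /eqP l; apply/idP/idP; first exact: H.
rewrite -(strip_conj true) => /H; rewrite strip_conj; apply.
by rewrite !level_conj_diagram.
Qed.

(** Harmonic functions on the Young graph: phi(la) is the sum of phi over the
    successors of la. *)
Definition harmonic (R : nmodType) (phi : diagram -> R) := forall la,
  strip_up true 1 phi la = phi la.

(** Harmonicity is preserved because adding a strip commutes with adding a cell. *)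
Lemma strip_up_harmonic (R : nmodType) (phi : diagram -> R) b m : harmonic phi ->
  harmonic (strip_up b m phi).
Proof.
move=> h la; have : strip_up b 1 (strip_up b m phi) la = strip_up b m phi la.
  by rewrite strip_up_comm; congr (strip_up _ _ _ _); apply/funext => mu; case: b;
    rewrite -?strip_up_one h.
by case: b; rewrite -?strip_up_one.
Qed.

Lemma sum_paths_from_harmonic (R : nmodType) (phi : diagram -> R) n nu : harmonic phi ->
  \sum_(q <- paths_from n nu) phi (last nu q) = phi nu.
Proof.
move=> h; elim: n nu => [|n IH] nu; first by rewrite big_cons big_nil addr0.
rewrite sum_paths_fromS (eq_bigr phi) => [|mu _]; last exact: IH.
by rewrite /succs big_filter -[RHS]h.
Qed.

(** Vertex number i of a finite path from the empty diagram. *)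
Definition path_vertex (p : seq diagram) (i : nat) : diagram := nth empty_diagram
  (empty_diagram :: p) i.

(** A function of infinite paths that depends only on the levels up to n. *)
Definition depends_upto (T : Type) n (f : (nat -> diagram) -> T) :=
  forall s s', (forall i, (i <= n)%N -> s i = s' i) -> f s = f s'.

(** Expectation, over the paths with n steps, of a function f when each path has
    weight phi at its endpoint. For harmonic phi it does not depend on n, if n is
    at least the level up to which f depends on the path. *)
Definition expect (R : realType) (phi : diagram -> R) n (f : (nat -> diagram) -> R) : R :=
  \sum_(p <- paths_from n empty_diagram) phi (last empty_diagram p) * f (path_vertex p).

Lemma path_vertex_last n p : p \in paths_from n empty_diagram ->
  path_vertex p n = last empty_diagram p.
Proof.
by rewrite mem_paths_from => /andP[/eqP <- _];
  rewrite /path_vertex -(nth_last empty_diagram) /=; case: p.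
Qed.

Lemma path_vertex_cat p q i : (i <= size p)%N -> path_vertex (p ++ q) i = path_vertex p i.
Proof. by rewrite /path_vertex -cat_cons => ip; rewrite nth_cat /= ltnS ip. Qed.

Lemma expect_cat (R : realType) (phi : diagram -> R) a n f g : depends_upto a f ->
  expect phi (a + n) (fun s => f s * g (s a) (s (a + n)%N)) =
  \sum_(p <- paths_from a empty_diagram) f (path_vertex p) *
    \sum_(q <- paths_from n (last empty_diagram p))
      phi (last (last empty_diagram p) q) * g (last empty_diagram p) (last (last empty_diagram
        p) q).
Proof.
move=> fa; rewrite /expect sum_paths_from_cat big_seq [RHS]big_seq; apply: eq_bigr => p pa.
rewrite mulr_sumr big_seq [RHS]big_seq; apply: eq_bigr => q qn.
have sp : size p = a by move: pa; rewrite mem_paths_from => /andP[/eqP].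
have pq : p ++ q \in paths_from (a + n) empty_diagram.
  move: qn pa; rewrite !mem_paths_from => /andP[/eqP <- h] /andP[/eqP <- h'].
  by rewrite size_cat eqxx cat_path h'.
rewrite (path_vertex_last pq) last_cat (_ : path_vertex _ a = last empty_diagram p); last first.
  by rewrite path_vertex_cat ?sp // path_vertex_last.
rewrite (fa (path_vertex (p ++ q)) (path_vertex p)); first by ring.
by move=> i ia; rewrite path_vertex_cat // sp.
Qed.

Lemma expect_harmonic (R : realType) (phi : diagram -> R) a n f : harmonic phi ->
  depends_upto a f ->
  (a <= n)%N -> expect phi n f = expect phi a f.
Proof.
move=> h fa an; rewrite -(subnKC an).
have := expect_cat phi (n - a) (fun _ _ => 1) fa => E.
rewrite (_ : expect phi (a + (n - a)) f = expect phi (a + (n - a)) (fun s => f s * 1));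
  last first.
  by congr expect; apply/funext => s; rewrite mulr1.
rewrite E; apply: eq_bigr => p _; rewrite mulrC; congr (_ * _).
under eq_bigr do rewrite mulr1; exact: sum_paths_from_harmonic.
Qed.

(** The statistic of the i-th block, between the levels m * i and m * i + m. Dividing by the
    number of paths through the block makes the sum over these paths count a
    strip exactly once, without choosing a path in it. *)
Definition block (R : realType) b m i (s : nat -> diagram) : R :=
  (strip b (s (m * i)) (s (m * i + m)))%:R / (path_count m (s (m * i)) (s (m * i + m)))%:R.

Lemma sum_paths_from_block (R : realType) (phi : diagram -> R) b m nu :
  \sum_(q <- paths_from m nu) phi (last nu q) *
     ((strip b nu (last nu q))%:R / (path_count m nu (last nu q))%:R) = strip_up b m phi nu.
Proof.
transitivity (\sum_(mu <- diagrams (level nu + m)) \sum_(q <- paths_from m nu | last nu q == mu)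
   phi mu * ((strip b nu mu)%:R / (path_count m nu mu)%:R)).
  rewrite (exchange_big_dep predT) //= big_seq [RHS]big_seq; apply: eq_bigr => q qm.
  have l := level_paths_from qm.
  rewrite (@sum_pick_seq _ _ _ _ _ (last nu q) (diagrams_uniq _)) ?eqxx ?mem_diagrams ?l //.
  by rewrite big1 ?addr0 // => mu /andP[/eqP -> /negP].
rewrite /strip_up [RHS]big_mkcond big_seq [RHS]big_seq; apply: eq_bigr => mu.
rewrite mem_diagrams => /eqP l; rewrite -big_filter big_const_seq.
case: ifP => s; last first.
  by rewrite mul0r mulr0; elim: (count _ _) => //= n ->; rewrite addr0.
rewrite mul1r count_predT size_filter -/(path_count m nu mu) iter_addr_0 -[LHS]mulr_natr -mulrA
  mulVf ?mulr1 //.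
by rewrite pnatr_eq0 -lt0n (path_count_gt0 s l).
Qed.

Lemma block_upto (R : realType) b m i : depends_upto (m * i + m) (@block R b m i).
Proof. by move=> s s' E; rewrite /block !E // leq_addr. Qed.

(** Integrating out a block replaces phi by [strip_up b m phi]; the steps after the
    block, and those between level a and the block, have no effect. *)
Lemma expect_block (R : realType) (phi : diagram -> R) b m a i n f : harmonic phi ->
  depends_upto a f ->
  (a <= m * i)%N -> (m * i + m <= n)%N ->
  expect phi n (fun s => f s * block R b m i s) = expect (strip_up b m phi) a f.
Proof.
move=> h fa ai im.
have fi : depends_upto (m * i) f by move=> s s' E; apply: fa => j ja; apply: E;
  exact: leq_trans ai.
have fb : depends_upto (m * i + m) (fun s => f s * block R b m i s).
  move=> s s' E; rewrite (block_upto R b E) (fa s s') // => j ja; apply: E.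
  by rewrite (leq_trans ja) // (leq_trans ai) // leq_addr.
rewrite (expect_harmonic h fb im) /block.
rewrite (expect_cat phi m (fun nu mu => (strip b nu mu)%:R / (path_count m nu mu)%:R) fi).
rewrite -(expect_harmonic (strip_up_harmonic b m h) fa ai); apply: eq_bigr => p _.
by rewrite mulrC sum_paths_from_block.
Qed.

Lemma expect1 (R : realType) (phi : diagram -> R) n : harmonic phi ->
  expect phi n (fun=> 1) = phi empty_diagram.
Proof.
by move=> h; rewrite /expect; under eq_bigr do rewrite mulr1; exact: sum_paths_from_harmonic.
Qed.

Lemma expect_block1 (R : realType) (phi : diagram -> R) b m i n : harmonic phi ->
  (m * i + m <= n)%N -> expect phi n (block R b m i) = strip_up b m phi empty_diagram.
Proof.
move=> h im; rewrite -(expect1 0 (strip_up_harmonic b m h)).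
rewrite -(@expect_block _ _ b m 0 i n (fun=> 1) h) //.
by congr expect; apply/funext => s; rewrite mul1r.
Qed.

(** The correlation of two distinct blocks does not depend on their positions. *)
Lemma expect_block2 (R : realType) (phi : diagram -> R) b m i j n : harmonic phi ->
  (i < j)%N -> (m * j + m <= n)%N ->
  expect phi n (fun s => block R b m i s * block R b m j s) = strip_up b m (strip_up b m phi)
    empty_diagram.
Proof.
move=> h ij jn; have ij' : (m * i + m <= m * j)%N by rewrite addnC -mulnS leq_mul2l ij orbT.
rewrite (expect_block b h (@block_upto R b m i) ij' jn).
exact: expect_block1 (strip_up_harmonic b m h) _.
Qed.

(** * Path weights of a central measure *)

(** Probabilities as real numbers. *)
Definition Pr (R : realType) (M : probability path_space R) (A : set path_space) : R := fine (M
  A).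

Lemma PrE (R : realType) (M : probability path_space R) A : measurable A -> M A = (Pr M A)%:E.
Proof. by move=> mA; rewrite fineK // fin_num_measure. Qed.

Lemma Pr_ge0 (R : realType) (M : probability path_space R) A : 0 <= Pr M A.
Proof. exact: fine_ge0. Qed.

Lemma Pr_T (R : realType) (M : probability path_space R) : Pr M setT = 1.
Proof. by rewrite /Pr probability_setT. Qed.

Lemma Pr_0 (R : realType) (M : probability path_space R) : Pr M set0 = 0.
Proof. by rewrite /Pr measure0. Qed.

Lemma Pr_le (R : realType) (M : probability path_space R) A B : measurable A -> measurable B ->
  A `<=` B -> Pr M A <= Pr M B.
Proof. by move=> mA mB AB; rewrite -lee_fin -!PrE // le_measure ?inE. Qed.

Lemma PrU (R : realType) (M : probability path_space R) A B : measurable A -> measurable B ->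
  A `&` B = set0 -> Pr M (A `|` B) = Pr M A + Pr M B.
Proof.
move=> mA mB AB; apply: EFin_inj; rewrite EFinD -!PrE //; last exact: measurableU.
by rewrite measureU.
Qed.

Lemma PrU_le (R : realType) (M : probability path_space R) A B : measurable A -> measurable B ->
  Pr M (A `|` B) <= Pr M A + Pr M B.
Proof.
move=> mA mB; rewrite -lee_fin EFinD -!PrE //; last exact: measurableU.
exact: measureU2.
Qed.

Lemma Pr_seq (R : realType) (M : probability path_space R) (T : eqType) (s : seq T)
   (P : pred T) (A : T -> set path_space) :
  uniq s -> (forall p, measurable (A p)) -> (forall p q t, A p t -> A q t -> p = q) ->
  measurable [set t | exists p, [/\ p \in s, P p & A p t]] /\
  Pr M [set t | exists p, [/\ p \in s, P p & A p t]] = \sum_(p <- s | P p) Pr M (A p).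
Proof.
move=> + mA dis; elim: s => [_|x s IH /= /andP[xs us]].
  rewrite big_nil (_ : mkset _ = set0) ?Pr_0 //.
  by apply/seteqP; split=> t //= -[p []].
have [mS PS] := IH us; rewrite big_cons.
case: ifP => Px; last first.
  rewrite (_ : mkset _ = [set t | exists p, [/\ p \in s, P p & A p t]]) //.
  apply/seteqP; split=> t /= [p [ps Pp Ap]]; exists p; split=> //; rewrite ?inE ?ps ?orbT //.
  by move: ps; rewrite inE => /orP[/eqP E|//]; rewrite -E Pp in Px.
rewrite (_ : mkset _ = A x `|` [set t | exists p, [/\ p \in s, P p & A p t]]); last first.
  apply/seteqP; split=> t /=.
    move=> [p [ps Pp Ap]]; move: ps; rewrite inE => /orP[/eqP <-|ps]; [by left|right].
    by exists p.
  move=> [Ax|[p [ps Pp Ap]]]; [exists x|exists p]; split=> //; rewrite inE ?eqxx ?ps ?orbT //.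
split; first exact: measurableU.
rewrite PrU ?PS //; apply/seteqP; split=> t //= -[Ax [p [ps _ Ap]]].
by move: xs; rewrite (dis _ _ _ Ax Ap) ps.
Qed.

Lemma cylinder_measurable i la : measurable ([set t : ipath | t i = la] : set path_space).
Proof. by apply: sub_sigma_algebra; exists i => //; exists la. Qed.

(** The first n steps of an infinite path. *)
Definition prefix_of n (t : ipath) : seq diagram := [seq vertex t i.+1 | i <- iota 0 n].

Lemma path_vertex_prefix_of n (t : ipath) i : (i <= n)%N -> path_vertex (prefix_of n t) i = t i.
Proof.
case: i => [_|i lt]; first by rewrite /path_vertex /= vertex0.
by rewrite /path_vertex /= (nth_map 0%N) ?size_iota // nth_iota.
Qed.

Lemma mem_prefix_of n (t : ipath) : prefix_of n t \in paths_from n empty_diagram.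
Proof.
rewrite mem_paths_from size_map size_iota eqxx /=.
apply/(pathP empty_diagram) => i; rewrite size_map size_iota => lt.
have := vertexS t i; rewrite -(path_vertex_prefix_of t (ltnW lt)) -(path_vertex_prefix_of t
  lt); exact.
Qed.

Lemma starts_withE p (t : ipath) : starts_with p t <-> prefix_of (size p) t = p.
Proof.
split=> [h|<-].
  apply: (@eq_from_nth _ empty_diagram) => [|i]; rewrite size_map size_iota // => lt.
  have := h i.+1 lt; rewrite -(path_vertex_prefix_of t lt); exact.
by move=> i; rewrite size_map size_iota => le; rewrite -(path_vertex_prefix_of t le).
Qed.

Lemma starts_with_measurable p : measurable (starts_with p).
Proof.
rewrite (_ : starts_with p = \bigcap_(i in [set i | (i <= size p)%N])
  ([set t : ipath | t i = nth empty_diagram (empty_diagram :: p) i] : set path_space)).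
  by apply: bigcap_measurable => [|i _]; [exists 0%N|exact: cylinder_measurable].
by apply/seteqP; split=> t /= h i; exact: h.
Qed.

(** Events that depend only on the levels up to n are finite disjoint unions of
    events [starts_with p]. *)
Lemma event_sum (R : realType) (M : probability path_space R) n (f : (nat -> diagram) -> bool) :
  depends_upto n f -> measurable ([set t : ipath | f t] : set path_space) /\
  Pr M [set t : ipath | f t] =
  \sum_(p <- paths_from n empty_diagram | f (path_vertex p)) Pr M (starts_with p).
Proof.
move=> uf; pose A p : set path_space := if size p == n then starts_with p else set0.
have [||mS PS] := @Pr_seq R M _ (paths_from n empty_diagram) (fun p =>
  f (path_vertex p)) A (paths_from_uniq _ _).
- by move=> p; rewrite /A; case: ifP => // _; exact: starts_with_measurable.
- move=> p q t; rewrite /A; case: eqP => // sp; case: eqP => // sq.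
  by move=> /starts_withE <- /starts_withE <-; rewrite sp sq.
have E : [set t : ipath | f t] = [set t | exists p, [/\ p \in paths_from n empty_diagram,
  f (path_vertex p) & A p t]].
  have ft (t : ipath) : f t = f (path_vertex (prefix_of n t)).
    by apply: uf => i le; rewrite path_vertex_prefix_of.
  apply/seteqP; split=> t /=.
    rewrite ft => h; exists (prefix_of n t); split=> //; first exact: mem_prefix_of.
    by rewrite /A size_map size_iota eqxx; apply/starts_withE; rewrite size_map size_iota.
  by move=> [p [ps fp]]; rewrite /A; case: eqP => // sp /starts_withE E; rewrite ft -sp E.
rewrite E; split=> //; rewrite PS big_seq_cond [RHS]big_seq_cond.
by apply: eq_bigr => p /andP[+ _]; rewrite mem_paths_from /A => /andP[-> _].
Qed.

Lemma through_starts_with la p : is_fpath la p -> starts_with p `<=` through la.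
Proof.
move=> /andP[_ /eqP <-] t h; exists (size p); rewrite (h _ (leqnn _)).
by rewrite -(nth_last empty_diagram) /=; case: (p).
Qed.

Lemma through_measurable la : measurable (through la).
Proof.
rewrite (_ : through la = \bigcup_i ([set t : ipath | t i = la] : set path_space)).
  by apply: bigcup_measurable => i _; exact: cylinder_measurable.
by apply/seteqP; split=> t /= [i]; [exists i|move=> _; exists i].
Qed.

(** Integrating the common conditional probability over all paths through la
    shows that the finite paths to la are equally probable. *)
Lemma central_Pr (R : realType) (M : probability path_space R) la p q : central M ->
  is_fpath la p -> is_fpath la q -> Pr M (starts_with p) = Pr M (starts_with q).
Proof.
move=> cM lp lq.
have [pos|npos] := boolP (0 < M (through la))%E.
  have [g gP] := cM la pos.
  (* The defining identity of the conditional probability is used for the whole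
     space only. *)
  have aT : after (level la) setT.
    rewrite /after; set G := (X in <<s X >>).
    have [s0 sC _] := smallest_sigma_algebra setT G.
    by have := sC _ s0; rewrite setD0.
  have E r : is_fpath la r ->
    (\int[M]_(x in setT `&` through la) (g x)%:E)%E = M (starts_with r).
    move=> lr; have [_ _ /(_ _ aT) ->] := gP r lr.
    rewrite setIT; congr (M _); apply/setIidPl; exact: through_starts_with.
  by rewrite /Pr -!E.
have Z r : is_fpath la r -> Pr M (starts_with r) = 0.
  move=> lr; apply/eqP; rewrite eq_le Pr_ge0 andbT.
  apply: le_trans (Pr_le M (starts_with_measurable r) (through_measurable la)
    (through_starts_with lr)) _.
  by rewrite -lee_fin -PrE; [rewrite leNgt|exact: through_measurable].
by rewrite !Z.
Qed.

Lemma fpath_ex la : exists p, is_fpath la p.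
Proof.
have [|p pp lp] := @path_ex empty_diagram la.
  by apply/asboolP => i; rewrite row_len_empty.
by exists p; rewrite /is_fpath pp lp eqxx.
Qed.

(** The probability of following a finite path to la; the path is arbitrary for a
    central measure (see [path_weightE]). *)
Definition path_weight (R : realType) (M : probability path_space R) la : R :=
  Pr M (starts_with (projT1 (cid (fpath_ex la)))).

Lemma path_weightE (R : realType) (M : probability path_space R) la p : central M ->
  is_fpath la p -> Pr M (starts_with p) = path_weight M la.
Proof. by move=> cM lp; apply: central_Pr cM lp _; exact: projT2 (cid (fpath_ex la)). Qed.

Lemma Pr_event (R : realType) (M : probability path_space R) n (f : (nat -> diagram) -> bool) :
  central M -> depends_upto n f ->
  Pr M [set t : ipath | f t] = expect (path_weight M) n (fun s => (f s)%:R).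
Proof.
move=> cM uf; have [_ ->] := event_sum M uf; rewrite big_mkcond /expect big_seq [RHS]big_seq.
apply: eq_bigr => p; rewrite mem_paths_from => /andP[_ pp].
case: (f _); last by rewrite mulr0.
by rewrite mulr1 (path_weightE (la := last empty_diagram p) cM) // /is_fpath pp eqxx.
Qed.

Lemma path_weight_ge0 (R : realType) (M : probability path_space R) la : 0 <= path_weight M la.
Proof. exact: Pr_ge0. Qed.

Lemma path_weight_empty (R : realType) (M : probability path_space R) : central M ->
  path_weight M empty_diagram = 1.
Proof.
move=> cM; rewrite -(path_weightE (p := [::]) cM) // -(Pr_T M); congr Pr.
by apply/seteqP; split=> t //= _; apply/starts_withE.
Qed.

Lemma path_weight_harmonic (R : realType) (M : probability path_space R) : central M ->
  harmonic (path_weight M).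
Proof.
move=> cM la; have [p lp] := fpath_ex la; move: (lp) => /andP[pp /eqP lastp].
pose n := size p.
pose f (s : nat -> diagram) := [forall i : 'I_n.+1, s i == path_vertex p i].
have uf : depends_upto n f.
  move=> s s' E; apply: eq_forallb => i; rewrite E // -ltnS; exact: ltn_ord.
have fE (t : ipath) : f t -> starts_with p t.
  by move=> /forallP h i le; have /eqP := h (Ordinal (le : (i < n.+1)%N)).
have fE' q : q \in paths_from n empty_diagram -> f (path_vertex q) = (q == p).
  rewrite mem_paths_from => /andP[/eqP sq _]; apply/forallP/eqP => [h|->//].
  apply: (@eq_from_nth _ empty_diagram) => // i; rewrite sq => lt.
  by have /eqP := h (Ordinal (lt : (i.+1 < n.+1)%N)).
have S n' : (n <= n')%N -> expect (path_weight M) n' (fun s => (f s)%:R) = path_weight M la.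
  move=> le; have uf' : depends_upto n' f.
    by move=> s s' E; apply: uf => i lei; apply: E; exact: leq_trans le.
  rewrite -Pr_event // -(path_weightE cM lp); congr Pr; apply/seteqP; split=> t /=;
    first exact: fE.
  by move=> h; apply/forallP => -[i lt] /=; apply/eqP/h.
have uR : depends_upto n (fun s => (f s)%:R : R) by move=> s s' E; rewrite (uf s s' E).
have := S n.+1 (leqnSn n); have := expect_cat (path_weight M) 1 (fun _ _ => 1) uR.
rewrite addn1; under eq_fun do rewrite mulr1.
move=> -> <-; rewrite big_seq.
have pn : p \in paths_from n empty_diagram by rewrite mem_paths_from eqxx pp.
rewrite -big_seq (bigD1_seq p) ?paths_from_uniq //= (fE' _ pn) eqxx mul1r.
rewrite [X in _ + X]big_seq_cond [X in _ + X]big1 ?addr0; last first.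
  by move=> q /andP[qn /negPf ne]; rewrite fE' // ne mul0r.
rewrite big_flatten big_map lastp /succs big_filter; apply: eq_bigr => mu _.
by rewrite big_seq1 mulr1.
Qed.

(** * Second moments of window averages *)

Lemma expect_le (R : realType) (phi : diagram -> R) n f g : (forall la, 0 <= phi la) ->
  (forall s, f s <= g s) -> expect phi n f <= expect phi n g.
Proof. by move=> p0 fg; apply: ler_sum => p _; exact: ler_wpM2l. Qed.

Lemma expectD (R : realType) (phi : diagram -> R) n f g :
  expect phi n (fun s => f s + g s) = expect phi n f + expect phi n g.
Proof. by rewrite -big_split; apply: eq_bigr => p _; rewrite mulrDr. Qed.

Lemma expectZ (R : realType) (phi : diagram -> R) n a f :
  expect phi n (fun s => a * f s) = a * expect phi n f.
Proof. by rewrite mulr_sumr; apply: eq_bigr => p _; rewrite mulrCA. Qed.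

Lemma expect_sum (R : realType) (phi : diagram -> R) n (I : Type) (r : seq I) P F :
  expect phi n (fun s => \sum_(i <- r | P i) F i s) = \sum_(i <- r | P i) expect phi n (F i).
Proof.
rewrite /expect exchange_big /=; apply: eq_bigr => p _; by rewrite mulr_sumr.
Qed.

Lemma eq_expect (R : realType) (phi : diagram -> R) n f g : f =1 g ->
  expect phi n f = expect phi n g.
Proof. by move=> fg; apply: eq_bigr => p _; rewrite fg. Qed.

Lemma block_ge0 (R : realType) b m i s : 0 <= block R b m i s.
Proof. by rewrite divr_ge0. Qed.

Lemma block_le1 (R : realType) b m i s : block R b m i s <= 1.
Proof.
rewrite /block; case: (path_count _ _ _) => [|k]; first by rewrite invr0 mulr0.
by rewrite ler_pdivrMr ?ltr0n // mul1r ler_nat; case: (strip _ _ _).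
Qed.

(** The average of F over the window [16^j, 2 * 16^j). *)
Definition avg (R : realType) j (F : nat -> R) : R :=
  (16 ^ j)%:R^-1 * \sum_(16 ^ j <= i < 2 * 16 ^ j) F i.

Lemma pow16_gt0 j : (0 < 16 ^ j)%N. Proof. by rewrite expn_gt0. Qed.

Lemma avg_const (R : realType) j (a : R) : avg j (fun=> a) = a.
Proof.
rewrite /avg big_const_nat iter_addr_0 -[X in _ * X]mulr_natr mulrCA.
rewrite (_ : 2 * 16 ^ j - 16 ^ j = 16 ^ j)%N; last by lia.
by rewrite mulVf ?mulr1 // pnatr_eq0 -lt0n pow16_gt0.
Qed.

Lemma avg_le (R : realType) j (F G : nat -> R) :
  (forall i, (16 ^ j <= i < 2 * 16 ^ j)%N -> F i <= G i) -> avg j F <= avg j G.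
Proof.
move=> FG; rewrite ler_wpM2l ?invr_ge0 // big_nat_cond [leRHS]big_nat_cond.
by apply: ler_sum => i /andP[ir _]; exact: FG.
Qed.

Lemma eq_avg (R : realType) j (F G : nat -> R) :
  (forall i, (16 ^ j <= i < 2 * 16 ^ j)%N -> F i = G i) -> avg j F = avg j G.
Proof. by move=> FG; congr (_ * _); exact: eq_big_nat. Qed.

Lemma avgD (R : realType) j (F G : nat -> R) :
  avg j (fun i => F i + G i) = avg j F + avg j G.
Proof. by rewrite /avg big_split mulrDr. Qed.

Lemma avg_mulr (R : realType) j (F : nat -> R) a : avg j F * a = avg j (fun i => F i * a).
Proof. by rewrite /avg -mulrA mulr_suml. Qed.

Lemma avg_mull (R : realType) j (F : nat -> R) a : a * avg j F = avg j (fun i => a * F i).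
Proof. by rewrite /avg mulrCA mulr_sumr. Qed.

Lemma expect_avg (R : realType) (phi : diagram -> R) n j F :
  expect phi n (fun s => avg j (F s)) = avg j (fun i => expect phi n (fun s => F s i)).
Proof. by rewrite /avg expectZ expect_sum. Qed.

(** The average of the block statistics over a window. Windows are disjoint, and
    move to infinity so that the averages do not see any finite part of the
    path. *)
Definition window (R : realType) b m j (s : nat -> diagram) : R :=
  avg j (fun i => block R b m i s).

Lemma window_ge0 (R : realType) b m j s : 0 <= window R b m j s.
Proof. by rewrite -[leLHS](avg_const j) avg_le // => i _; exact: block_ge0. Qed.

Lemma window_le1 (R : realType) b m j s : window R b m j s <= 1.
Proof. by rewrite -[leRHS](avg_const j) avg_le // => i _; exact: block_le1. Qed.

Lemma window_upto (R : realType) b m j : depends_upto (m * (2 * 16 ^ j)) (window R b m j).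
Proof.
move=> s s' E; apply: eq_avg => i /andP[_ lt].
apply: block_upto => k le; apply: E; apply: leq_trans le _.
by rewrite addnC -mulnS leq_mul2l lt orbT.
Qed.

Lemma window_tail (R : realType) b m j (s s' : nat -> diagram) :
  (forall i, (m * 16 ^ j <= i)%N -> s i = s' i) -> window R b m j s = window R b m j s'.
Proof.
move=> E; apply: eq_avg => i /andP[le _].
have h : (m * 16 ^ j <= m * i)%N by rewrite leq_mul2l le orbT.
by rewrite /block !E // (leq_trans h) // leq_addr.
Qed.

Lemma strip_up_ge0 (R : realType) (phi : diagram -> R) b m la :
  (forall la, 0 <= phi la) -> 0 <= strip_up b m phi la.
Proof. by move=> p0; rewrite sumr_ge0. Qed.

Lemma expect_window_mul (R : realType) (phi : diagram -> R) b m j j' n :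
  expect phi n (fun s => window R b m j s * window R b m j' s) =
  avg j (fun i => avg j' (fun i' => expect phi n (fun s =>
    block R b m i s * block R b m i' s))).
Proof.
under eq_expect do rewrite avg_mulr.
rewrite expect_avg; apply: eq_avg => i _.
by under eq_expect do rewrite avg_mull; rewrite expect_avg.
Qed.

Lemma block_end m j i n : (i < 2 * 16 ^ j)%N -> (m * (2 * 16 ^ j) <= n)%N -> (m * i + m <= n)%N.
Proof.
move=> lt; apply: leq_trans.
by rewrite addnC -mulnS leq_mul2l lt orbT.
Qed.

Lemma expect_window_cross (R : realType) (phi : diagram -> R) b m j n : harmonic phi ->
  (m * (2 * 16 ^ j.+1) <= n)%N ->
  expect phi n (fun s => window R b m j s * window R b m j.+1 s) = strip_up b m (strip_up b m
    phi) empty_diagram.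
Proof.
move=> h jn; rewrite expect_window_mul -[RHS](avg_const j); apply: eq_avg => i /andP[_ li].
rewrite -[RHS](avg_const j.+1); apply: eq_avg => i' /andP[gi' li'].
apply: expect_block2 => //; last exact: block_end li' jn.
apply: leq_trans li _; apply: leq_trans gi'; rewrite expnS leq_mul2r.
by rewrite orbT.
Qed.

(** Only the diagonal of the double sum, of relative size 16^-j, may exceed the
    common correlation of distinct blocks. *)
Lemma expect_window_square (R : realType) (phi : diagram -> R) b m j n : harmonic phi ->
  (forall la, 0 <= phi la) -> phi empty_diagram = 1 -> (m * (2 * 16 ^ j) <= n)%N ->
  expect phi n (fun s => window R b m j s * window R b m j s) <=
    strip_up b m (strip_up b m phi) empty_diagram + (16 ^ j)%:R^-1.
Proof.
move=> h p0 p1 jn; set d := strip_up b m (strip_up b m phi) _.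
have d0 : 0 <= d by apply: strip_up_ge0 => la; exact: strip_up_ge0.
rewrite expect_window_mul -[leRHS](avg_const j); apply: avg_le => i /[dup] ir /andP[gi li].
apply: (@le_trans _ _ (avg j (fun i' => d + (i' == i)%:R))).
  apply: avg_le => i' /andP[_ li'].
  case: (ltngtP i' i) => [lt|lt|eq]; rewrite ?addr0.
  - under eq_expect do rewrite mulrC.
    by rewrite (expect_block2 b h lt) // (block_end li jn).
  - by rewrite (expect_block2 b h lt) // (block_end li' jn).
  apply: (@le_trans _ _ (expect phi n (fun=> 1))).
    apply: expect_le => // s; apply: mulr_ile1; rewrite ?block_ge0 ?block_le1 //.
  by rewrite expect1 // p1 lerDr.
rewrite avgD avg_const lerD2l /avg.
rewrite (bigD1_seq i) ?iota_uniq ?mem_index_iota //= eqxx big1 ?addr0 ?mulr1 //.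
by move=> i' /negPf ->.
Qed.

Lemma expect_window_diff (R : realType) (phi : diagram -> R) b m j n : harmonic phi ->
  (forall la, 0 <= phi la) -> phi empty_diagram = 1 -> (m * (2 * 16 ^ j.+1) <= n)%N ->
  expect phi n (fun s => (window R b m j s - window R b m j.+1 s) ^+ 2) <= 2 / (16 ^ j)%:R.
Proof.
move=> h p0 p1 jn.
have jn' : (m * (2 * 16 ^ j) <= n)%N.
  apply: leq_trans jn; rewrite leq_mul2l leq_mul2l leq_exp2l //.
  by rewrite leqnSn !orbT.
have s1 := expect_window_square b h p0 p1 jn'; have s2 := expect_window_square b h p0 p1 jn.
have s3 := expect_window_cross b h jn.
have -> : expect phi n (fun s => (window R b m j s - window R b m j.+1 s) ^+ 2) =
    expect phi n (fun s => window R b m j s * window R b m j s) +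
    (expect phi n (fun s => window R b m j.+1 s * window R b m j.+1 s) +
    (- 2) * expect phi n (fun s => window R b m j s * window R b m j.+1 s)).
  by rewrite -expectZ -!expectD; apply: eq_expect => s; ring.
have s4 : (16 ^ j.+1)%:R^-1 <= (16 ^ j)%:R^-1 :> R.
  by rewrite lef_pV2 ?posrE ?ltr0n ?pow16_gt0 // ler_nat leq_exp2l.
rewrite s3; lra.
Qed.

(** * The Pieri rule from ergodicity *)

Lemma window_event (R : realType) b m j (P : R -> bool) :
  measurable ([set t : ipath | P (window R b m j t)] : set path_space).
Proof.
(* Measurability does not involve the measure; any one will do. *)
have M0 : probability path_space R by exact: (dirac (one_row_path : path_space)).
apply: (proj1 (@event_sum R M0 (m * (2 * 16 ^ j)) (fun s => P (window R b m j s)) _)).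
by move=> s s' E; rewrite (window_upto _ b E).
Qed.

(** The averages over two consecutive windows differ by more than 2^-j. *)
Definition jump (R : realType) b m j : set path_space :=
  [set t : ipath | 2 ^- j < `|window R b m j t - window R b m j.+1 t|].

Lemma jump_upto (R : realType) b m j :
  depends_upto (m * (2 * 16 ^ j.+1)) (fun s =>
    2 ^- j < `|window R b m j s - window R b m j.+1 s|).
Proof.
move=> s s' E; rewrite (window_upto R b E) (window_upto R b (s' := s') (s := s)) // => i le.
apply: E; apply: leq_trans le _; rewrite leq_mul2l leq_mul2l leq_exp2l //.
by rewrite leqnSn !orbT.
Qed.

(** Chebyshev bound: 4^j * (2 / 16^j) = 2 / 4^j, which is summable in j. *)
Lemma Pr_jump (R : realType) (M : probability path_space R) b m j : central M ->
  measurable (jump R b m j) /\ Pr M (jump R b m j) <= 2 / 4 ^+ j.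
Proof.
move=> cM; have uj := @jump_upto R b m j.
split; first by have [] := event_sum M uj.
rewrite (Pr_event cM uj).
have h := path_weight_harmonic cM.
apply: (@le_trans _ _ (expect (path_weight M) (m * (2 * 16 ^ j.+1)) (fun s => 4 ^+ j *
   (window R b m j s - window R b m j.+1 s) ^+ 2))).
  apply: expect_le => [la|s]; first exact: path_weight_ge0.
  set x := _ - _; have -> : (4 : R) ^+ j = 2 ^+ j ^+ 2 by rewrite -exprM mulnC exprM;
    congr (_ ^+ _); rewrite expr2 -natrM.
  rewrite -exprMn; case: ltP => [lt|_]; last exact: sqr_ge0.
  rewrite -[_ ^+ 2]real_normK ?num_real // normrM (ger0_norm (exprn_ge0 _ _)) //.
  rewrite expr_ge1 ?mulr_ge0 //; apply: ltW.
  by rewrite -ltr_pdivrMl ?exprn_gt0 // mulr1.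
rewrite expectZ; apply: (@le_trans _ _ (4 ^+ j * (2 / (16 ^ j)%:R))).
  by rewrite ler_wpM2l ?exprn_ge0 // expect_window_diff // ?path_weight_empty // => la;
    exact: path_weight_ge0.
rewrite natrX (_ : 16%:R = 4 * 4 :> R); last by rewrite -natrM.
have : (4 : R) ^+ j != 0 by rewrite expf_neq0.
rewrite exprMn; move: (4 ^+ j) => x x0.
by rewrite le_eqVlt; apply/orP; left; apply/eqP; field.
Qed.

(** From window J on, resp. from some window on, the averages are at most q. *)
Definition le_from (R : realType) b m (q : R) J : set path_space :=
  [set t : ipath | forall j, (J <= j)%N -> window R b m j t <= q].
Definition eventually_le (R : realType) b m (q : R) : set path_space :=
  \bigcup_J le_from b m q J.

Lemma le_from_measurable (R : realType) b m (q : R) J : measurable (le_from b m q J).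
Proof.
rewrite (_ : le_from b m q J = \bigcap_(j in [set j | (J <= j)%N])
   ([set t : ipath | window R b m j t <= q] : set path_space)).
  apply: bigcap_measurable => [|j _]; first by exists J => /=.
  exact: (@window_event R b m j (fun x => x <= q)).
by apply/seteqP; split=> t /= h i; exact: h.
Qed.

Lemma eventually_le_measurable (R : realType) b m (q : R) : measurable (eventually_le b m q).
Proof. by apply: bigcup_measurable => J _; exact: le_from_measurable. Qed.

(** The blocks of window j start at level j or later, so a change of finitely many levels
    affects finitely many windows only. The blocks must not be empty. *)
Lemma eventually_le_tail (R : realType) b m (q : R) (s t : path_space) :
  tail_equiv s t -> eventually_le b m.+1 q s -> eventually_le b m.+1 q t.
Proof.
move=> [N E] [J _ h]; exists (maxn J N) => // j le.
have gtj : (j <= 16 ^ j)%N by rewrite ltnW // ltn_expl.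
rewrite -(@window_tail R b m.+1 j (s : ipath) (t : ipath)).
  by apply: h; apply: leq_trans le; exact: leq_maxl.
move=> i lei; apply: E; apply: leq_trans (leq_maxr J N) _; apply: leq_trans le _.
by apply: leq_trans gtj _; apply: leq_trans lei; exact: leq_pmull.
Qed.

Lemma eventually_le_mono (R : realType) b m (q q' : R) : q <= q' ->
  eventually_le b m q `<=` eventually_le b m q'.
Proof. by move=> qq t [J _ h]; exists J => // j /h le; exact: le_trans le qq. Qed.

Lemma window_upper (R : realType) (M : probability path_space R) b m (q e : R) :
  Pr M (eventually_le b m q) = 1 -> 0 < e ->
  exists J0, forall J, (J0 <= J)%N -> Pr M [set t : ipath | q < window R b m J t] <= e.
Proof.
move=> p1 e0; have mU := @le_from_measurable R b m q.
have c : (M \o le_from b m q) J @[J --> \oo] --> 1%:E.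
  rewrite -p1 -PrE; last exact: eventually_le_measurable.
  apply: nondecreasing_cvg_mu => //; first exact: eventually_le_measurable.
  move=> J J' JJ; apply/subsetPset => t h j le; apply: h; exact: leq_trans JJ le.
have /fine_cvg c' := c.
have : \forall J \near \oo, 1 - e < Pr M (le_from b m q J).
  by apply: (cvgr_gt (1 : R)) => //; rewrite ltrBlDr ltrDl.
move=> [J0 _ h]; exists J0 => J le.
have mE : measurable ([set t : ipath | q < window R b m J t] : set path_space).
  exact: (@window_event R b m J (fun x => q < x)).
have : Pr M ([set t : ipath | q < window R b m J t] `|` le_from b m q J) <= 1.
  by rewrite -(Pr_T M); apply: Pr_le => //; exact: measurableU.
rewrite PrU //; last first.
  by apply/seteqP; split=> t //= -[+ /(_ J (leqnn J))]; rewrite ltNge => /negP.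
have := h J le => /=; lra.
Qed.

Lemma Pr_jumps (R : realType) (M : probability path_space R) b m J : central M ->
  Pr M (\bigcup_k jump R b m (J + k)) <= 3 / 4 ^+ J.
Proof.
move=> cM; have mj j : measurable (jump R b m j) by have [] := Pr_jump b m j cM.
rewrite -lee_fin -PrE; last by apply: bigcup_measurable => k _; exact: mj.
apply: le_trans (@measure_sigma_subadditive _ _ _ M _ (fun k =>
  jump R b m (J + k)) _ _ _) _ => //.
  by apply: bigcup_measurable => k _; exact: mj.
apply: lime_le; first by apply: is_cvg_nneseries => n _ _; exact: measure_ge0.
apply: nearW => n /=.
rewrite (eq_bigr (fun k => (Pr M (jump R b m (J + k)))%:E)) => [|k _]; last by rewrite PrE.
rewrite sumEFin lee_fin.
(* The partial sum of the geometric series of the bounds 2 / 4^(J + k). *)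
apply: (@le_trans _ _ (8 / 3 * (1 - 4 ^- n) / 4 ^+ J)); last first.
  rewrite ler_wpM2r ?invr_ge0 ?exprn_ge0 //.
  have : 0 <= (4 : R) ^- n by rewrite invr_ge0 exprn_ge0.
  lra.
elim: n => [|n IH]; first by rewrite big_geq // expr0 invr1 subrr mulr0 mul0r.
rewrite big_nat_recr //=.
have [_ le] := Pr_jump b m (J + n) cM.
apply: le_trans (lerD IH le) _.
rewrite exprD exprS !invfM.
have : 0 <= (4 : R) ^- n by rewrite invr_ge0 exprn_ge0.
have : 0 <= (4 : R) ^- J by rewrite invr_ge0 exprn_ge0.
move: (4 ^- n) (4 ^- J) => x y y0 x0.
by rewrite le_eqVlt; apply/orP; left; apply/eqP; field.
Qed.

(** For J large, a path whose average over window J is at most q - e and which has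
    no jump afterwards keeps its averages below q, because 2^-j is summable. *)
Lemma window_lower (R : realType) (M : probability path_space R) b m (q e : R) : central M ->
  Pr M (eventually_le b m q) = 0 -> 0 < e ->
  exists J0, forall J, (J0 <= J)%N -> Pr M [set t : ipath | window R b m J t <= q - e] <= e.
Proof.
move=> cM p0 e0.
have c2 : (3 / 2 ^+ J : R) @[J --> \oo] --> 0.
  rewrite -[X in _ --> X](mulr0 3); apply: cvgM; first exact: cvg_cst.
  under eq_fun do rewrite -exprVn; apply: cvg_expr; rewrite ger0_norm ?invr_ge0 // invf_lt1 //.
  lra.
have : \forall J \near \oo, (3 / 2 ^+ J : R) < e by apply: (cvgr_lt (0 : R)).
move=> [J0 _ h]; exists J0 => J le; have {h} := h J le => /= hJ.
have mE : measurable ([set t : ipath | window R b m J t <= q - e] : set path_space).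
  exact: (@window_event R b m J (fun x => x <= q - e)).
have mj j : measurable (jump R b m j) by have [] := Pr_jump b m j cM.
have mJ : measurable (\bigcup_k jump R b m (J + k)) by apply: bigcup_measurable => k _;
  exact: mj.
have mS := @eventually_le_measurable R b m q.
have y0 : 0 < (2 : R) ^- J by rewrite invr_gt0 exprn_gt0.
have y1 : (2 : R) ^- J <= 1 by rewrite invf_le1 ?exprn_gt0 // exprn_ege1 // ler1n.
apply: (@le_trans _ _ (Pr M (eventually_le b m q `|` \bigcup_k jump R b m (J + k)))).
  apply: Pr_le => //; first exact: measurableU.
  move=> t /= tq; have [|nj] := pselect ((\bigcup_k jump R b m (J + k)) t); first by right.
  left; exists J => // j Jj; rewrite -(subnKC Jj).
  have step k : `|window R b m (J + k) t - window R b m (J + k).+1 t| <= 2 ^- (J + k).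
    by rewrite leNgt; apply/negP => lt; apply: nj; exists k.
  (* The jumps after window J add up to less than 2 * 2^-J < e. *)
  have : forall k, window R b m (J + k) t <= q - e + 2 * 2 ^- J * (1 - 2 ^- k).
    elim=> [|k IH]; first by rewrite addn0 expr0 invr1 subrr mulr0 addr0.
    have := step k; rewrite ler_norml => /andP[lo _].
    rewrite addnS; move: lo IH; rewrite exprD exprS !invfM.
    move: (2 ^- k) (2 ^- J) (window R b m (J + k) t) (window _ _ _ _ _) => x y u v; lra.
  move=> /(_ (j - J)%N); have : 0 <= (2 : R) ^- (j - J) by rewrite invr_ge0 exprn_ge0.
  move: (2 ^- (j - J)) => x x0 le'; apply: le_trans le' _; nra.
apply: le_trans (PrU_le M mS mJ) _; rewrite p0 add0r.
apply: le_trans (Pr_jumps b m J cM) _.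
apply: le_trans (ltW hJ); rewrite ler_wpM2l // lef_pV2 ?posrE ?exprn_gt0 //.
by rewrite lerXn2r ?nnegrE // ler_nat.
Qed.

Lemma strip_up0 (R : nmodType) b (phi : diagram -> R) la : strip_up b 0 phi la = phi la.
Proof.
rewrite /strip_up addn0 (@sum_pick_seq _ _ _ _ _ la (diagrams_uniq _)) ?mem_diagrams
  ?strip_refl //.
rewrite big_seq_cond big1 ?addr0 // => mu; rewrite mem_diagrams => /and3P[/eqP l s /negP[]].
by rewrite (strip_level_eq s).
Qed.

Lemma expect_start (R : realType) (phi : diagram -> R) p n : harmonic phi ->
  path young_edge empty_diagram p -> (size p <= n)%N ->
  expect phi n (fun s => [forall i : 'I_(size p).+1, s i == path_vertex p i]%:R) =
  phi (last empty_diagram p).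
Proof.
move=> h pp le.
have ux : depends_upto (size p) (fun s => [forall i : 'I_(size p).+1,
  s i == path_vertex p i]%:R : R).
  by move=> s s' E; congr (_%:R); congr nat_of_bool; apply: eq_forallb => i; rewrite E // -ltnS.
rewrite (expect_harmonic h ux le) /expect (bigD1_seq p) ?paths_from_uniq ?mem_paths_from ?pp
  ?eqxx //=.
rewrite (_ : [forall i, _] = true) ?mulr1; last by apply/forallP.
rewrite big_seq_cond big1 ?addr0 // => q /andP[]; rewrite mem_paths_from => /andP[/eqP sq _] ne.
rewrite (_ : [forall i, _] = false) ?mulr0 //; apply/negP => /forallP E; case/eqP: ne.
apply: (@eq_from_nth _ empty_diagram) => // i; rewrite sq => lt.
by have /eqP := E (Ordinal (lt : (i.+1 < (size p).+1)%N)).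
Qed.

(** The constant is the infimum of the q such that almost surely the averages are
    eventually at most q; by ergodicity the averages are close to it with
    probability tending to one. *)
Lemma path_weight_eigen (R : realType) (M : probability path_space R) b m : central M ->
  ergodic M ->
  exists c, forall la, strip_up b m (path_weight M) la = c * path_weight M la.
Proof.
(* Strips of size zero are trivial, and blocks of size zero useless. *)
move=> cM eM; case: m => [|m]; first by exists 1 => la; rewrite strip_up0 mul1r.
pose S q := eventually_le b m.+1 (q : R).
have mS q : measurable (S q) by exact: eventually_le_measurable.
have zo q : Pr M (S q) = 0 \/ Pr M (S q) = 1.
  case: (eM (S q) (mS q)) => [s t st|E|E].
  - exact: eventually_le_tail.
  - by left; rewrite /Pr E.
  - by right; rewrite /Pr E.
pose Q := [set q | Pr M (S q) = 1].
have Q1 : Q 1.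
  rewrite /Q /= -[RHS](Pr_T M); congr Pr; apply/seteqP; split=> // t _; exists 0%N => // j _.
  exact: window_le1.
have Q0 : lbound Q 0.
  move=> q Qq; rewrite leNgt; apply/negP => q0; move: Qq; rewrite /Q /=.
  rewrite (_ : S q = set0) ?Pr_0 => [/esym/eqP|]; first by rewrite oner_eq0.
  apply/seteqP; split=> // t [J _ /(_ J (leqnn J))].
  by move=> le; have := le_lt_trans le q0; rewrite ltNge window_ge0.
pose c := inf Q; have c0 : 0 <= c by apply: lb_le_inf => //; exists 1.
have c1 : c <= 1 by apply: ge_inf => //; exists 0.
exists c => la; set phi := path_weight M.
have h : harmonic phi := path_weight_harmonic cM.
have p0 mu : 0 <= phi mu := path_weight_ge0 M mu.
have p1 : phi empty_diagram = 1 := path_weight_empty cM.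
(* For J large, the difference is the expectation of X * (window J - c), where
   X is the indicator of starting with a path to la. *)
have main e : 0 < e -> `|strip_up b m.+1 phi la - c * phi la| <= 5 * e.
  move=> e0.
  have hi : Pr M (S (c + e)) = 1.
    have ltc : c < c + e by rewrite ltrDl.
    have [q Qq lt] := inf_lt (ex_intro _ 1 Q1 : Q !=set0) ltc.
    apply/eqP; rewrite eq_le; apply/andP; split; first by rewrite -[leRHS](Pr_T M);
      exact: Pr_le.
    by rewrite -Qq; apply: Pr_le => //; apply: eventually_le_mono; exact: ltW.
  have lo : Pr M (S (c - e)) = 0.
    case: (zo (c - e)) => // E; have : c <= c - e by apply: ge_inf => //; exists 0.
    lra.
  have [J1 H1] := window_upper hi e0; have [J2 H2] := window_lower cM lo e0.
  have [p /andP[pp /eqP lp]] := fpath_ex la.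
  pose J := maxn (maxn J1 J2) (size p); pose n := (m.+1 * (2 * 16 ^ J))%N.
  have {}H1 := H1 J (leq_trans (leq_maxl J1 J2) (leq_maxl _ _)).
  have {}H2 := H2 J (leq_trans (leq_maxr J1 J2) (leq_maxl _ _)).
  have sp16 : (size p <= 16 ^ J)%N.
    by apply: leq_trans (leq_maxr (maxn J1 J2) _) _; rewrite ltnW // ltn_expl.
  have spn : (size p <= n)%N by rewrite /n; nia.
  pose X s : R := [forall i : 'I_(size p).+1, s i == path_vertex p i]%:R.
  have uX : depends_upto (size p) X.
    by move=> s s' E; congr (_%:R); congr nat_of_bool; apply: eq_forallb => i;
      rewrite E // -ltnS.
  have E1 : expect phi n X = phi la by rewrite expect_start // lp.
  have E2 : expect phi n (fun s => X s * window R b m.+1 J s) = strip_up b m.+1 phi la.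
    under eq_expect do rewrite avg_mull.
    rewrite expect_avg -[RHS](avg_const J); apply: eq_avg => i /andP[gi li].
    rewrite (expect_block b h uX); [|by nia|exact: block_end li (leqnn _)].
    by rewrite expect_start ?lp //; exact: strip_up_harmonic.
  have uP P : depends_upto n (fun s => P (window R b m.+1 J s) : bool).
    by move=> s s' E; rewrite (window_upto R b E).
  have B1 := Pr_event cM (uP (fun x => c + e < x)).
  have B2 := Pr_event cM (uP (fun x => x <= c - e - e)).
  have -> : strip_up b m.+1 phi la - c * phi la = expect phi n (fun s =>
    X s * (window R b m.+1 J s - c)).
    rewrite -E1 -E2 -mulNr -expectZ -expectD; apply: eq_expect => s; ring.
  apply: (@le_trans _ _ (expect phi n (fun s =>
    2 * e * 1 + ((c + e < window R b m.+1 J s)%R%:R +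
      (window R b m.+1 J s <= c - e - e)%R%:R)))).
    apply: le_trans (ler_norm_sum _ _ _) _; apply: ler_sum => q _.
    rewrite normrM (ger0_norm (p0 _)) ler_wpM2l // mulr1.
    have w0 := window_ge0 R b m.+1 J (path_vertex q);
      have w1 := window_le1 R b m.+1 J (path_vertex q).
    apply: (@le_trans _ _ `|window R b m.+1 J (path_vertex q) - c|).
      rewrite normrM /X; case: [forall i, _]; first by rewrite normr1 mul1r.
      by rewrite normr0 mul0r.
    move: (window _ _ _ _ _) w0 w1 => w w0 w1; rewrite ler_norml.
    by case: (ltP (c + e) w) => ?; case: (leP w (c - e - e)) => ?; apply/andP; split;
      rewrite /=; lra.
  rewrite !expectD expectZ expect1 // p1 -B1 -B2; lra.
apply/eqP; rewrite -subr_eq0 -normr_le0; apply/ler_addgt0Pl => e e0; rewrite addr0.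
by have := main (e / 5); rewrite divr_gt0 // => /(_ isT); rewrite mulrCA mulfV ?mulr1.
Qed.

(** * Assembling the Thoma measure *)

Lemma positive_pieri_path_weight (R : realType) (M : probability path_space R) : central M ->
  ergodic M ->
  positive_pieri (path_weight M).
Proof.
move=> cM eM; split=> [la||b m la]; [exact: path_weight_ge0|exact: path_weight_empty|].
have [c E] := path_weight_eigen b m cM eM.
by rewrite !E path_weight_empty // mulr1.
Qed.

Lemma vertex_level (t : ipath) n : level (t n) = n.
Proof.
by have := level_paths_from (mem_prefix_of n t);
  rewrite -(path_vertex_last (mem_prefix_of n t)) path_vertex_prefix_of // level_empty.
Qed.

Lemma through_event la : through la = [set t : ipath | t (level la) == la].
Proof.
apply/seteqP; split=> t /=; last by move=> /eqP h; exists (level la).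
by move=> [n E]; rewrite -E vertex_level.
Qed.

Lemma measure_through (R : realType) (M : probability path_space R) la : central M ->
  M (through la) = ((young_dim la)%:R * path_weight M la)%:E.
Proof.
move=> cM; rewrite PrE; last exact: through_measurable.
have u : depends_upto (level la) (fun s => s (level la) == la) by move=> s s' E; rewrite E.
rewrite through_event (Pr_event cM u) /expect; congr (_%:E).
transitivity (\sum_(p <- paths_from (level la) empty_diagram | last empty_diagram p == la)
  path_weight M la).
  rewrite [RHS]big_mkcond big_seq [RHS]big_seq; apply: eq_bigr => p pn.
  rewrite (path_vertex_last pn); case: eqP => [->|_]; last by rewrite mulr0.
  by rewrite mulr1.
rewrite -big_filter big_const_seq count_predT iter_addr_0 -[LHS]mulr_natl; congr (_%:R * _).
apply: perm_size; apply: uniq_perm; rewrite ?filter_uniq ?paths_from_uniq ?fset_uniq // => p.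
rewrite (in_fset_set (finite_fpaths la)) mem_filter mem_paths_from.
apply/andP/idP => [[lp /andP[_ pp]]|/set_mem /= /andP[pp lp]].
  by apply: mem_set; rewrite /= /is_fpath pp lp.
rewrite lp pp andbT; split=> //; have := @level_paths_from (size p) empty_diagram p.
by rewrite mem_paths_from eqxx pp (eqP lp) level_empty => /(_ isT) ->.
Qed.

Lemma hook_supported_path_weight (R : realType) (M : probability path_space R) k l : central M
  ->
  M (hook_paths k l) = 1%E -> hook_supported k l (path_weight M).
Proof.
move=> cM hM la nh.
have [p lp] := fpath_ex la; rewrite -(path_weightE cM lp).
have mH : measurable (hook_paths k l).
  rewrite (_ : hook_paths k l = \bigcap_n ([set t : ipath | in_hook k l (t n)] : set
    path_space)).
    apply: bigcap_measurable => [|n _]; first by exists 0%N.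
    apply: (proj1 (@event_sum R M n (fun s => in_hook k l (s n)) _)).
    by move=> s s' E; rewrite E.
  by apply/seteqP; split=> t /= h i; [move=> _|]; exact: h.
have : Pr M (starts_with p `|` hook_paths k l) <= 1.
  by rewrite -(Pr_T M); apply: Pr_le => //; apply: measurableU => //;
    exact: starts_with_measurable.
rewrite PrU //; [|exact: starts_with_measurable|].
  rewrite [Pr M (hook_paths _ _)]/Pr hM /= => le; apply/eqP; rewrite eq_le Pr_ge0 andbT; lra.
apply/seteqP; split=> t //= -[s hk].
by have [n E] := through_starts_with lp s; have := hk n; rewrite E (negPf nh).
Qed.

Lemma sorted_nth_le (R : realType) (s : seq R) (i j n : nat) :
  size s = n -> (i <= j < n)%N ->
  nth 0 (sort (fun x y => y <= x) s) j <= nth 0 (sort (fun x y => y <= x) s) i.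
Proof.
move=> sn /andP[ij jn].
have tot : total (fun x y : R => y <= x) by move=> x y; exact: le_total.
have tr : transitive (fun x y : R => y <= x) by move=> x y z xy yz; exact: le_trans yz xy.
apply: (sorted_leq_nth tr) => //; rewrite ?inE ?size_sort ?sn //; last exact: leq_ltn_trans jn.
exact: sort_sorted.
Qed.

Lemma sort_nth_ge0 (R : realType) (s : seq R) i : all (fun x => 0 <= x) s ->
  0 <= nth 0 (sort (fun x y => y <= x) s) i.
Proof.
move=> s0; have [lt|ge] := ltnP i (size (sort (fun x y : R => y <= x) s));
  last by rewrite nth_default.
by move/allP: s0; apply; rewrite -(mem_sort (fun x y => y <= x)) mem_nth.
Qed.

(** Values at the diagram with one cell, for the normalisation of the parameters. *)
Lemma strip_down_cell (R : realType) b (x : R) f : 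
  strip_down b x f (row_shape 1) = f (row_shape 1) + x * f empty_diagram.
Proof.
rewrite /strip_down level_row_shape (@sum_pick_seq _ _ _ _ _ (row_shape 1) (diagrams_upto_uniq
  _)) ?mem_diagrams_upto ?level_row_shape ?strip_refl //.
rewrite subnn mul1r; congr (_ + _).
have se : strip b empty_diagram (row_shape 1).
  by apply/asboolP => -[|i]; rewrite !row_len_row_shape !row_len_empty; case: b.
rewrite (@sum_pick_seq _ _ _ _ _ empty_diagram (diagrams_upto_uniq _)) ?mem_diagrams_upto ?se
  //=; last first.
  by apply/eqP => /(congr1 level); rewrite level_row_shape.
rewrite big1 ?addr0 ?expr1 // => nu /andP[/andP[s ne] ne'].
have := strip_level s; rewrite level_row_shape leq_eqVlt => /orP[/eqP l|].
  by move: ne; rewrite (strip_level_eq s) ?eqxx // level_row_shape.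
by rewrite ltnS leqn0 => /eqP /level_eq0 E; rewrite E eqxx in ne'.
Qed.

Lemma strip_down_empty (R : realType) b (x : R) f : strip_down b x f empty_diagram = f
  empty_diagram.
Proof. by rewrite /strip_down diagrams_upto0 big_cons big_nil strip_refl mul1r addr0. Qed.

Lemma foldr_down_empty (R : realType) b (s : seq R) f :
  foldr (strip_down b) f s empty_diagram = f empty_diagram.
Proof. by elim: s => //= x s IH; rewrite strip_down_empty. Qed.

Lemma foldr_down_cell (R : realType) b (s : seq R) f :
  foldr (strip_down b) f s (row_shape 1) = f (row_shape 1) + \sum_(x <- s) x * f empty_diagram.
Proof.
elim: s => [|x s IH] /=; first by rewrite big_nil addr0.
by rewrite strip_down_cell IH foldr_down_empty big_cons addrAC addrA addrAC.
Qed.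

Theorem theorem3 (R : realType) (k l : nat) (hkl : (0 < k + l)%N)
    (M : probability path_space R) (Mcentral : central M) (Mergodic : ergodic M)
    (Mhook : M (hook_paths k l) = 1%E) :
  exists (alpha : 'I_k -> R) (beta : 'I_l -> R),
    [/\ (forall i i' : 'I_k, (i <= i')%N -> alpha i' <= alpha i)
          /\ (forall i, 0 <= alpha i),
        (forall j j' : 'I_l, (j <= j')%N -> beta j' <= beta j)
          /\ (forall j, 0 <= beta j),
        \sum_(i < k) alpha i + \sum_(j < l) beta j = 1 &
        forall la : diagram,
          M (through la) = ((young_dim la)%:R * hook_schur la alpha beta)%:E].
Proof.
have g := positive_pieri_path_weight Mcentral Mergodic.
have [s [t [[sl tk] s0 t0 E]]] := peel_all g (hook_supported_path_weight Mcentral Mhook).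
pose srt (u : seq R) := sort (fun x y => y <= x) u.
have szs : size (srt s) = l by rewrite size_sort.
have szt : size (srt t) = k by rewrite size_sort.
pose alpha (i : 'I_k) := nth 0 (srt t) i; pose beta (j : 'I_l) := nth 0 (srt s) j.
have schurE la : path_weight M la = hook_schur la alpha beta.
  rewrite (@hook_schur_ordinal_schur _ _ _ _ _ _ (fun v => if (v < k)%N then nth 0 (srt t) v
      else nth 0 (srt s) (k + l - v.+1))); first last.
  - move=> j; have := ltn_ord j => lj.
    rewrite ifF; last by apply/negbTE; rewrite -leqNgt; lia.
    by congr nth; lia.
  - by move=> i; rewrite ltn_ord.
  rewrite ordinal_schur_foldr // E.
  (* The parameters come out of the peeling unsorted, and the horizontal strips in
     the opposite order to the alphabet. *)
  rewrite (@foldr_down_perm _ true _ (rev (srt t)) t); last by rewrite perm_rev perm_sort.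
  by rewrite (@foldr_down_perm _ false _ (srt s) s) // perm_sort.
exists alpha, beta; split.
- split=> [i i' le|i]; last exact: sort_nth_ge0.
  by apply: (sorted_nth_le tk); rewrite le ltn_ord.
- split=> [i i' le|i]; last exact: sort_nth_ge0.
  by apply: (sorted_nth_le sl); rewrite le ltn_ord.
- have [_ one _] := g.
  have h : path_weight M (row_shape 1) = 1.
    by rewrite -(strip_up_empty_row (path_weight M)) path_weight_harmonic.
  rewrite -h E !foldr_down_cell foldr_down_empty.
  have d1 : delta R (row_shape 1) = 0.
    by rewrite /delta; case: eqP => // /(congr1 level); rewrite level_row_shape.
  rewrite d1 add0r /delta eqxx.
  have sum u n : size u = n -> \sum_(i < n) nth 0 (srt u) i = \sum_(x <- u) x * 1 :> R.
    move=> su; under [RHS]eq_bigr do rewrite mulr1.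
    have p : perm_eq (srt u) u by rewrite perm_sort.
    by rewrite -(perm_big _ p) (big_nth 0) big_mkord size_sort su.
  by rewrite /alpha /beta (sum t) // (sum s).
- by move=> la; rewrite measure_through // schurE.
Qed.
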